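(* Let $\mathcal{H},\mathcal{K}$ be Hilbert spaces, let $A_1,\ldots,A_n\in\mathbb{P}(\mathcal{H})$ be such that $mI\le A_j\le MI$ $(j=1,\ldots,n)$ for some scalars $0<m<M$, let $h=M/m$, and let $\Phi:\mathbb{B}(\mathcal{H})\to\mathbb{B}(\mathcal{K})$ be a unital positive linear map. Let $\mathfrak{M}$ be an $n$-variable operator mean (on $\mathbb{P}(\mathcal{H})$ and on $\mathbb{P}(\mathcal{K})$) such that $\mathcal{H}_\omega\le\mathfrak{M}\le\mathcal{A}_\omega$ for some probability vector $\omega=(\omega_1,\ldots,\omega_n)$, and let $\sigma$ be a ($2$-variable) operator mean with $\sigma\ne\ell$. Then for each $\alpha>0$ $$\mathfrak{M}_\sigma(\Phi(A_1^r),\ldots,\Phi(A_n^r))\le\alpha\,\Phi\left(\mathfrak{M}_\sigma(A_1,\ldots,A_n)^r\right)+\gamma\left(\frac1M,\frac1m,-r,\alpha K(h,r)^{-1}\right)I$$ for all $r\ge1$.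
   Context: $\mathbb{B}(\mathcal{H})$ is the algebra of bounded linear operators on a Hilbert space $\mathcal{H}$, $\mathbb{B}(\mathcal{H})^+$ its cone of positive operators, $\mathbb{P}(\mathcal{H})$ the set of positive invertible operators; $\le$ is the operator (Loewner) order, $I$ the identity, SOT the strong operator topology. A ($2$-variable, Kubo--Ando) operator mean is a map $\sigma:\mathbb{B}(\mathcal{H})^+\times\mathbb{B}(\mathcal{H})^+\to\mathbb{B}(\mathcal{H})^+$ with: (i) $A\le C,\ B\le D\Rightarrow A\sigma B\le C\sigma D$; (ii) $C(A\sigma B)C\le (CAC)\sigma(CBC)$ for $C\in\mathbb{B}(\mathcal{H})^+$; (iii) $A_k\searrow A,\ B_k\searrow B\Rightarrow A_k\sigma B_k\searrow A\sigma B$ (decreasing sequences converging in SOT); (iv) $I\sigma I=I$. Operator means correspond one-to-one to nonnegative operator monotone functions $f_\sigma$ on $(0,\infty)$ with $f_\sigma(1)=1$ via $A\sigma B=A^{1/2}f_\sigma(A^{-1/2}BA^{-1/2})A^{1/2}$ for positive invertible $A,B$ (so $\sigma$ makes sense on every Hilbert space). The left trivial mean is $A\ell B=A$. An $n$-variable operator mean is a map $\mathfrak{M}:\mathbb{P}(\mathcal{H})^n\to\mathbb{P}(\mathcal{H})$ with: (I) $A_j\le B_j$ for all $j$ implies $\mathfrak{M}(A_1,\ldots,A_n)\le\mathfrak{M}(B_1,\ldots,B_n)$; (II) $S^*\mathfrak{M}(A_1,\ldots,A_n)S=\mathfrak{M}(S^*A_1S,\ldots,S^*A_nS)$ for every invertible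 $S\in\mathbb{B}(\mathcal{H})$; (III) if either $A_{jk}\nearrow A_j$ or $A_{jk}\searrow A_j$ as $k\to\infty$ for each $j$ (all in $\mathbb{P}(\mathcal{H})$), then $\mathfrak{M}(A_{1k},\ldots,A_{nk})\to\mathfrak{M}(A_1,\ldots,A_n)$ in SOT; (IV) $\mathfrak{M}(I,\ldots,I)=I$. The same symbol $\mathfrak{M}$ denotes a mean with these properties on $\mathbb{P}(\mathcal{K})$ when it is applied to operators on $\mathcal{K}$, and all stated hypotheses on $\mathfrak{M}$ are meant on both spaces. For an $n$-variable operator mean $\mathfrak{M}$ and an operator mean $\sigma\ne\ell$, the deformed mean $\mathfrak{M}_\sigma(A_1,\ldots,A_n)$ is the unique solution $X\in\mathbb{P}$ of $X=\mathfrak{M}(X\sigma A_1,\ldots,X\sigma A_n)$ (existence and uniqueness are known, and $\mathfrak{M}_\sigma$ is again an $n$-variable operator mean). A probability vector has $\omega_j\ge0$, $\sum_j\omega_j=1$. $\mathcal{A}_\omega(A_1,\ldots,A_n)=\sum_j\omega_jA_j$ and $\mathcal{H}_\omega(A_1,\ldots,A_n)=(\sum_j\omega_jA_j^{-1})^{-1}$; $\mathcal{H}_\omega\le\mathfrak{M}\le\mathcal{A}_\omega$ means the inequality holds at every $n$-tuple of positive invertible operators. For $0<m<M$, $r\in\mathbb{R}\setminus\{0,1\}$, $\alpha>0$, put $t_0=\left(\frac{M^r-m^r}{\alpha r(M-m)}\right)^{1/(r-1)}$ and $$\gamma(m,M,r,\alpha)=\begin{cases}\alpha(r-1)\left(\frac{M^r-m^r}{\alpha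 r(M-m)}\right)^{r/(r-1)}+\frac{Mm^r-mM^r}{M-m}&\text{if } m\le t_0\le M,\\ (1-\alpha)M^r&\text{if } M\le t_0,\\ (1-\alpha)m^r&\text{if } t_0\le m.\end{cases}$$ In the claim this is evaluated with $(m,M,r,\alpha)$ replaced by $(1/M,1/m,-r,\alpha K(h,r)^{-1})$. The generalized Kantorovich constant is $K(h,p)=\frac{h^p-h}{(p-1)(h-1)}\left(\frac{p-1}{p}\frac{h^p-1}{h^p-h}\right)^p$, extended by continuity where the formula is undefined, so $K(h,1)=1$. *)

(* Defs.v *)
From HB Require Import structures.
From mathcomp Require Import all_boot all_order all_algebra.
From mathcomp Require Import complex.
From mathcomp Require Import all_classical all_reals all_analysis.

Set Implicit Arguments.
Unset Strict Implicit.
Unset Printing Implicit Defensive.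

Import Order.TTheory GRing.Theory Num.Theory.
Import numFieldNormedType.Exports.

Local Open Scope classical_set_scope.
Local Open Scope ring_scope.
Local Open Scope complex_scope.

(* Complex Hilbert spaces; the inner product is linear in its first argument. *)
HB.mixin Record isInnerProductSpace (R : realType) H
    & CompleteNormedModule R[i] H := {
  inner : H -> H -> R[i];
  innerDl : forall x y z, inner (x + y) z = inner x z + inner y z;
  innerZl : forall (c : R[i]) x y, inner (c *: x) y = c * inner x y;
  inner_conj : forall x y, inner y x = Num.conj (inner x y);
  inner_norm : forall x, inner x x = `|x| ^+ 2
}.

#[short(type="hilbertType")]
HB.structure Definition Hilbert (R : realType) :=
  {H of CompleteNormedModule R[i] H & isInnerProductSpace R H}.

Record bop (R : realType) (H : hilbertType R) := Bop {
  bop_fun :> H -> H;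
  bop_linear : linear bop_fun;
  bop_bounded : exists c : R, forall x, `|bop_fun x| <= c%:C * `|x|
}.

Section Algebra.
Variables (R : realType) (H : hilbertType R).
Implicit Types A B C : bop H.

Lemma bop_ext A B : A =1 B -> A = B.
Proof.
case: A B => [f lf bf] [g lg bg] /= /funext fg.
by move: lf bf; rewrite fg => lf bf; congr Bop; exact: Prop_irrelevance.
Qed.

Lemma bopD A x y : A (x + y) = A x + A y.
Proof. by have := bop_linear A 1 x y; rewrite !scale1r. Qed.

Lemma bopZ A c x : A (c *: x) = c *: A x.
Proof.
have A0 : A 0 = 0.
  by have /(canLR (addrK _)) := bopD A 0 0; rewrite addr0 subrr.
by have := bop_linear A c x 0; rewrite A0 !addr0.
Qed.

Lemma bop0_linear : linear (fun _ : H => 0 : H).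
Proof. by move=> c x y; rewrite scaler0 addr0. Qed.

Lemma bop0_bounded : exists c : R, forall x : H, `|0 : H| <= c%:C * `|x|.
Proof. by exists 0 => x; rewrite normr0 mul0r. Qed.

Definition bop0 := Bop bop0_linear bop0_bounded.

Lemma bop1_linear : linear (@id H). Proof. by []. Qed.

Lemma bop1_bounded : exists c : R, forall x : H, `|x| <= c%:C * `|x|.
Proof. by exists 1 => x; rewrite mul1r. Qed.

Definition bop1 := Bop bop1_linear bop1_bounded.

Lemma bop_opp_linear A : linear (fun x => - A x).
Proof. by move=> c x y; rewrite bop_linear opprD scalerN. Qed.

Lemma bop_opp_bounded A : exists c : R, forall x, `|- A x| <= c%:C * `|x|.
Proof. by have [c cP] := bop_bounded A; exists c => x; rewrite normrN. Qed.

Definition bop_opp A := Bop (bop_opp_linear A) (bop_opp_bounded A).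

Lemma bop_add_linear A B : linear (fun x => A x + B x).
Proof. by move=> c x y; rewrite !bop_linear scalerDr addrACA. Qed.

Lemma bop_add_bounded A B :
  exists c : R, forall x, `|A x + B x| <= c%:C * `|x|.
Proof.
have [c cP] := bop_bounded A; have [d dP] := bop_bounded B.
exists (c + d) => x; rewrite rmorphD mulrDl.
by apply: le_trans (ler_normD _ _) _; apply: lerD.
Qed.

Definition bop_add A B := Bop (bop_add_linear A B) (bop_add_bounded A B).

Lemma bop_scale_linear (a : R[i]) A : linear (fun x => a *: A x).
Proof. by move=> c x y; rewrite bop_linear scalerDr !scalerA mulrC. Qed.

Lemma bop_scale_bounded (a : R[i]) A :
  exists c : R, forall x, `|a *: A x| <= c%:C * `|x|.
Proof.
have [c cP] := bop_bounded A; exists (complex.Re `|a| * c) => x.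
have -> : ((complex.Re `|a| * c)%:C = `|a| * c%:C :> R[i]).
  by rewrite rmorphM /=; congr (_ * _); rewrite RRe_real // normr_real.
by rewrite normrZ -mulrA ler_wpM2l.
Qed.

Definition bop_scale a A := Bop (bop_scale_linear a A) (bop_scale_bounded a A).

Lemma bop_comp_linear A B : linear (fun x => A (B x)).
Proof. by move=> c x y; rewrite !bop_linear. Qed.

Lemma bop_comp_bounded A B : exists c : R, forall x, `|A (B x)| <= c%:C * `|x|.
Proof.
have [c cP] := bop_bounded A; have [d dP] := bop_bounded B.
exists (`|c| * d) => x.
apply: le_trans (cP _) _; rewrite rmorphM -mulrA.
apply: (@le_trans _ _ (`|c|%:C * `|B x|)).
  by rewrite ler_wpM2r // lecR ler_norm.
by rewrite ler_wpM2l // lecR.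
Qed.

Definition bop_comp A B := Bop (bop_comp_linear A B) (bop_comp_bounded A B).

HB.instance Definition _ := gen_eqMixin (bop H).
HB.instance Definition _ := gen_choiceMixin (bop H).

Lemma bop_addA : associative bop_add.
Proof. by move=> A B C; apply: bop_ext => x /=; rewrite addrA. Qed.
Lemma bop_addC : commutative bop_add.
Proof. by move=> A B; apply: bop_ext => x /=; rewrite addrC. Qed.
Lemma bop_add0 : left_id bop0 bop_add.
Proof. by move=> A; apply: bop_ext => x /=; rewrite add0r. Qed.
Lemma bop_addN : left_inverse bop0 bop_opp bop_add.
Proof. by move=> A; apply: bop_ext => x /=; rewrite addNr. Qed.

HB.instance Definition _ :=
  GRing.isZmodule.Build (bop H) bop_addA bop_addC bop_add0 bop_addN.

Lemma bop_compA : associative bop_comp.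
Proof. by move=> A B C; exact: bop_ext. Qed.
Lemma bop_comp1l : left_id bop1 bop_comp.
Proof. by move=> A; exact: bop_ext. Qed.
Lemma bop_comp1r : right_id bop1 bop_comp.
Proof. by move=> A; exact: bop_ext. Qed.
Lemma bop_compDl : left_distributive bop_comp +%R.
Proof. by move=> A B C; exact: bop_ext. Qed.
Lemma bop_compDr : right_distributive bop_comp +%R.
Proof. by move=> A B C; apply: bop_ext => x /=; rewrite bopD. Qed.

(* [H] may be the zero space, in which case 1 = 0 in [bop H]. *)
HB.instance Definition _ := GRing.Zmodule_isPzRing.Build (bop H)
  bop_compA bop_comp1l bop_comp1r bop_compDl bop_compDr.

Lemma bop_scaleA a b A : bop_scale a (bop_scale b A) = bop_scale (a * b) A.
Proof. by apply: bop_ext => x /=; rewrite scalerA. Qed.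
Lemma bop_scale1 : left_id 1 bop_scale.
Proof. by move=> A; apply: bop_ext => x /=; rewrite scale1r. Qed.
Lemma bop_scaleDr : right_distributive bop_scale +%R.
Proof. by move=> a A B; apply: bop_ext => x /=; rewrite scalerDr. Qed.
Lemma bop_scaleDl A : {morph bop_scale^~ A : a b / a + b}.
Proof. by move=> a b; apply: bop_ext => x /=; rewrite scalerDl. Qed.

HB.instance Definition _ := GRing.Zmodule_isLmodule.Build R[i] (bop H)
  bop_scaleA bop_scale1 bop_scaleDr bop_scaleDl.

End Algebra.

Section Operators.
Variables (R : realType) (H : hilbertType R).
Implicit Types A B S X : bop H.

Definition scalar_op (c : R) : bop H := c%:C *: (1 : bop H).

(* [0 <= z] in [R[i]] includes that z is real; on a complex space this makes A
   self-adjoint. *)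
Definition positive A := forall x, 0 <= inner (A x) x.

Definition op_le A B := positive (B - A).

Definition invertible A := exists B, A * B = 1 /\ B * A = 1.

Definition posinv A := positive A /\ invertible A.

Definition op_inv A : bop H := xget 0 [set B : bop H | A * B = 1 /\ B * A = 1].

Definition adjoint A : bop H :=
  xget 0 [set B : bop H | forall x y, inner (A x) y = inner x (B y)].

Definition sot_cvg (A_ : nat -> bop H) A :=
  forall x, A_ k x @[k --> \oo] --> A x.

Definition sot_decr (A_ : nat -> bop H) A :=
  (forall k, op_le (A_ k.+1) (A_ k)) /\ sot_cvg A_ A.

Definition sot_incr (A_ : nat -> bop H) A :=
  (forall k, op_le (A_ k) (A_ k.+1)) /\ sot_cvg A_ A.

Definition op_poly (p : {poly R}) A : bop H :=
  \sum_(i < size p) (p`_i)%:C *: A ^+ i.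

Definition opnorm_le A (c : R) := forall x, `|A x| <= c%:C * `|x|.

(* Continuous functional calculus f(A) of a self-adjoint A: the norm limit of
   p(A) as the real polynomials p converge to f uniformly on an interval
   [a, b] with aI <= A <= bI. *)
Definition is_fun_calc (f : R -> R) A B :=
  exists a b : R, [/\ op_le (scalar_op a) A, op_le A (scalar_op b) &
    forall e : R, 0 < e -> exists p : {poly R},
      (forall t, a <= t <= b -> `|p.[t] - f t| <= e) /\
      opnorm_le (op_poly p A - B) e].

Definition fun_calc (f : R -> R) A : bop H := xget 0 [set B : bop H | is_fun_calc f A B].

Definition op_pow A (r : R) : bop H := fun_calc (fun t => t `^ r) A.

End Operators.

(* Only the values of [s] on positive operators matter. *)
Definition kubo_ando (R : realType) (E : hilbertType R)
    (s : bop E -> bop E -> bop E) : Prop :=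
  [/\ forall A B, positive A -> positive B -> positive (s A B),
      forall A B C D, positive A -> positive B -> positive C -> positive D ->
        op_le A C -> op_le B D -> op_le (s A B) (s C D),
      forall A B C, positive A -> positive B -> positive C ->
        op_le (C * s A B * C) (s (C * A * C) (C * B * C)),
      forall (A_ B_ : nat -> bop E) A B,
        (forall k, positive (A_ k)) -> (forall k, positive (B_ k)) ->
        positive A -> positive B -> sot_decr A_ A -> sot_decr B_ B ->
        sot_decr (fun k => s (A_ k) (B_ k)) (s A B) &
      s 1 1 = 1].

Definition operator_monotone (R : realType) (f : R -> R) : Prop :=
  (forall t, 0 < t -> {for t, continuous f}) /\
  (forall (E : hilbertType R) (A B : bop E), posinv A -> posinv B ->
     op_le A B -> op_le (fun_calc f A) (fun_calc f B)).

Definition represents (R : realType) (f : R -> R)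
    (E : hilbertType R) (s : bop E -> bop E -> bop E) : Prop :=
  forall A B, posinv A -> posinv B ->
    s A B = op_pow A (1/2)
            * fun_calc f (op_pow A (- (1/2)) * B * op_pow A (- (1/2)))
            * op_pow A (1/2).

(* An operator mean lives on all Hilbert spaces at once; the maps on different
   spaces are tied together by the common representing function. *)
Definition operator_mean (R : realType)
    (s : forall E : hilbertType R, bop E -> bop E -> bop E) : Prop :=
  (forall E, kubo_ando (s E)) /\
  exists f : R -> R,
    [/\ operator_monotone f, forall t, 0 < t -> 0 <= f t, f 1 = 1 &
        forall E, represents f (s E)].

Definition is_left_trivial (R : realType)
    (s : forall E : hilbertType R, bop E -> bop E -> bop E) : Prop :=
  forall E (A B : bop E), positive A -> positive B -> s E A B = A.

(* Monotone continuity is required only along sequences that are monotone in the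
   same direction for all j. *)
Definition nvar_mean (R : realType) (n : nat) (E : hilbertType R)
    (F : ('I_n -> bop E) -> bop E) : Prop :=
  [/\ forall A, (forall j, posinv (A j)) -> posinv (F A),
      forall A B, (forall j, posinv (A j)) -> (forall j, posinv (B j)) ->
        (forall j, op_le (A j) (B j)) -> op_le (F A) (F B),
      forall A S, (forall j, posinv (A j)) -> invertible S ->
        adjoint S * F A * S = F (fun j => adjoint S * A j * S),
      forall (A_ : 'I_n -> nat -> bop E) A,
        (forall j k, posinv (A_ j k)) -> (forall j, posinv (A j)) ->
        (forall j, sot_incr (A_ j) (A j)) \/
        (forall j, sot_decr (A_ j) (A j)) ->
        sot_cvg (fun k => F (fun j => A_ j k)) (F A) &
      F (fun=> 1) = 1].

Definition deformed (R : realType) (n : nat) (E : hilbertType R)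
    (F : ('I_n -> bop E) -> bop E) (s : bop E -> bop E -> bop E)
    (A : 'I_n -> bop E) : bop E :=
  xget 0 [set X : bop E | posinv X /\ X = F (fun j => s X (A j))].

Definition arith_mean (R : realType) (n : nat) (E : hilbertType R)
    (w : 'I_n -> R) (A : 'I_n -> bop E) : bop E :=
  \sum_j (w j)%:C *: A j.

Definition harm_mean (R : realType) (n : nat) (E : hilbertType R)
    (w : 'I_n -> R) (A : 'I_n -> bop E) : bop E :=
  op_inv (\sum_j (w j)%:C *: op_inv (A j)).

Definition between_harm_arith (R : realType) (n : nat) (E : hilbertType R)
    (w : 'I_n -> R) (F : ('I_n -> bop E) -> bop E) : Prop :=
  forall A, (forall j, posinv (A j)) ->
    op_le (harm_mean w A) (F A) /\ op_le (F A) (arith_mean w A).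

Section Constants.
Variable R : realType.
Implicit Types m M r a h p : R.

Definition gamma_t0 m M r a : R :=
  ((M `^ r - m `^ r) / (a * r * (M - m))) `^ (1 / (r - 1)).

(* The cases overlap only where their values agree. *)
Definition gamma m M r a : R :=
  let t0 := gamma_t0 m M r a in
  if m <= t0 <= M then
    a * (r - 1) * ((M `^ r - m `^ r) / (a * r * (M - m))) `^ (r / (r - 1))
    + (M * m `^ r - m * M `^ r) / (M - m)
  else if M <= t0 then (1 - a) * M `^ r
  else (1 - a) * m `^ r.

(* The limits of the formula at p = 0, at p = 1 and at h = 1 are all 1. *)
Definition kantorovich h p : R :=
  if [|| h == 1, p == 0 | p == 1] then 1
  else (h `^ p - h) / ((p - 1) * (h - 1))
       * ((p - 1) / p * ((h `^ p - 1) / (h `^ p - h))) `^ p.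

End Constants.

(* Main.v *)
Require Import Defs.
From HB Require Import structures.
From mathcomp Require Import all_boot all_order all_algebra.
From mathcomp Require Import complex.
From mathcomp Require Import all_classical all_reals all_analysis.
From mathcomp Require Import ring lra.
From mathcomp Require polyrcf.

Set Implicit Arguments.
Unset Strict Implicit.
Unset Printing Implicit Defensive.
Import Order.TTheory GRing.Theory Num.Theory.
Import numFieldNormedType.Exports.
Local Open Scope classical_set_scope.
Local Open Scope ring_scope.
Local Open Scope complex_scope.

(* Let f represent sigma.  Both f and its adjoint t |-> 1 / f(1/t) are operator
   monotone, hence concave, so they lie below tangent lines at 1 of positive
   slope (sigma is not the left trivial mean).  Inserted in the fixed point
   equation X = M(X sigma A_1, ..., X sigma A_n) with H_w <= M <= A_w, the two
   tangents give X <= A_w(A) and X^-1 <= sum_j w_j A_j^-1; the fixed point itself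
   is the strong limit of the decreasing iteration started at the upper bound.

   Fix a vector x and put y = <Phi(sum_j w_j A_j^-1) x, x> / |x|^2.  The chord of
   t^-r on [1/M, 1/m] bounds every A_j^r by an affine function of A_j^-1, so the
   left-hand side is at most chord(y), which is at most (alpha / K) y^-r + gamma
   by the choice of gamma.  The tangent of t^-r at y, applied to X^-1, gives
   y^-r <= <Phi(X^r) x, x> / |x|^2, and alpha / K <= alpha because K >= 1. *)

(** * The underlying real inner product *)

(** The functional calculus is given by polynomial approximation, so its order properties rest on
    one fact: if [p] >= 0 on [a, b] and aI <= A <= bI, then p(A) is positive. Such a [p] is a
    product of factors nonnegative on [a, b], each of them positive at A, and a product of commuting
    positive operators is positive. Concavity of f is tested on C^2, since operator monotonicity is
    assumed on every Hilbert space.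

    Positivity of the slope c is essential: the upper tangent yields X <= X + c (A_w(A) - X), where
    X cancels and c is divided out. Each tangent serves one side: the left-hand mean needs an upper
    bound, while the mean under Phi on the right needs a lower one, stated for X^-1. The inverse is
    the natural variable, because t^r = (t^-1)^(-r) is convex in t^-1, which ranges over [1/M, 1/m];
    hence the arguments of [gamma]. Phi only meets inequalities affine in operators, and these it
    preserves. *)

Section RealInner.
Variables (R : realType) (H : hilbertType R).
Implicit Types (x y z : H) (c : R) (A B : bop H).

Definition rip x y : R := complex.Re (inner x y).
Definition nr x : R := complex.Re `|x|.
Definition qf A x : R := rip (A x) x.
Definition selfadj A := forall x y, inner (A x) y = inner x (A y).

Lemma ReD (u v : R[i]) : complex.Re (u + v) = complex.Re u + complex.Re v.
Proof. by case: u v => [a b] [c d]. Qed.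

Lemma ReZ c (u : R[i]) : complex.Re (c%:C * u) = c * complex.Re u.
Proof. by case: u => [a b] /=; rewrite mul0r subr0. Qed.

Lemma Reconj (u : R[i]) : complex.Re (Num.conj u) = complex.Re u.
Proof. by case: u. Qed.

Lemma inner0l y : inner (0 : H) y = 0.
Proof. by rewrite -(scale0r (0 : H)) innerZl mul0r. Qed.

Lemma innerDr x y z : inner x (y + z) = inner x y + inner x z.
Proof. by rewrite inner_conj innerDl rmorphD /= -!inner_conj. Qed.

Lemma innerZr (k : R[i]) x y : inner x (k *: y) = Num.conj k * inner x y.
Proof. by rewrite inner_conj innerZl rmorphM /= -inner_conj. Qed.

Lemma innerNl x y : inner (- x) y = - inner x y.
Proof. by rewrite -scaleN1r innerZl mulN1r. Qed.

Lemma innerNr x y : inner x (- y) = - inner x y.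
Proof. by rewrite -scaleN1r innerZr rmorphN1 mulN1r. Qed.

Lemma ripDl x y z : rip (x + y) z = rip x z + rip y z.
Proof. by rewrite /rip innerDl ReD. Qed.

Lemma ripC x y : rip x y = rip y x.
Proof. by rewrite /rip inner_conj Reconj. Qed.

Lemma ripDr x y z : rip x (y + z) = rip x y + rip x z.
Proof. by rewrite !(ripC x) ripDl. Qed.

Lemma ripZl c x y : rip (c%:C *: x) y = c * rip x y.
Proof. by rewrite /rip innerZl ReZ. Qed.

Lemma ripZr c x y : rip x (c%:C *: y) = c * rip x y.
Proof. by rewrite !(ripC x) ripZl. Qed.

Lemma ripNl x y : rip (- x) y = - rip x y.
Proof. by rewrite /rip innerNl; case: (inner x y). Qed.

Lemma ripNr x y : rip x (- y) = - rip x y.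
Proof. by rewrite !(ripC x) ripNl. Qed.

Lemma rip0l y : rip 0 y = 0.
Proof. by rewrite /rip inner0l. Qed.

Lemma nrE x : `|x| = (nr x)%:C.
Proof. by rewrite /nr RRe_real // normr_real. Qed.

Lemma nr_ge0 x : 0 <= nr x.
Proof. by have := normr_ge0 x; rewrite nrE lecR. Qed.

Lemma ripxx x : rip x x = nr x ^+ 2.
Proof. by rewrite /rip inner_norm nrE -rmorphXn. Qed.

Lemma nr_eq0 x : nr x = 0 -> x = 0.
Proof. by move=> x0; apply/eqP; rewrite -normr_eq0 nrE x0. Qed.

Lemma nrD x y : nr (x + y) <= nr x + nr y.
Proof. by have := ler_normD x y; rewrite !nrE -rmorphD lecR. Qed.

Lemma nrN x : nr (- x) = nr x.
Proof. by rewrite /nr normrN. Qed.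

Lemma nrZ c x : nr (c%:C *: x) = `|c| * nr x.
Proof.
by rewrite /nr normrZ normc_def /= expr0n addr0 sqrtr_sqr ReZ.
Qed.

(** Polarization: the sesquilinear form [S] measures the failure of symmetry and vanishes on the
    diagonal, so S x y + S y x = 0. Replacing y by iy gives S y x = S x y, hence both are zero. *)
Lemma positive_selfadj A : positive A -> selfadj A.
Proof.
move=> A0; pose S x y := inner (A x) y - inner x (A y).
have Sxx x : S x x = 0.
  by rewrite /S (inner_conj (A x)) conj_Creal ?subrr // ger0_real.
have SD x y : S x y + S y x = 0.
  have -> : S x y + S y x = S (x + y) (x + y) - S x x - S y y.
    by rewrite /S bopD !innerDl !innerDr; ring.
  by rewrite !Sxx !subr0.
move=> x y; apply/eqP; rewrite -subr_eq0; apply/eqP.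
have e1 := SD x y; have e2 := SD x ('i%C *: y).
have ci : Num.conj ('i%C : R[i]) = - 'i%C by apply/eqP; rewrite eq_complex /= ?oppr0 !eqxx.
have i0 : 'i%C != 0 :> R[i] by rewrite eq_complex /= oner_eq0 andbF.
have : 'i%C * (S y x - S x y) = 0.
  by move: e2; rewrite /S !bopZ !innerZl !innerZr ci => <-; ring.
move=> /eqP; rewrite mulf_eq0 (negPf i0) /= subr_eq0 => /eqP e3.
move: e1; rewrite e3 -mulr2n => /eqP; rewrite mulrn_eq0 /= => /eqP.
by rewrite /S.
Qed.

Lemma positiveP A : positive A <-> selfadj A /\ forall x, 0 <= qf A x.
Proof.
split=> [A0|[sA A0] x].
  by split; [exact: positive_selfadj|move=> x; have := A0 x; rewrite lecE => /andP[]].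
rewrite lecE; apply/andP; split; last exact: A0.
have := inner_conj (A x) x; rewrite -(sA x x).
by case: (inner (A x) x) => a b /= [bE]; apply/eqP; lra.
Qed.
End RealInner.

(** * Operator order *)

Section OperatorOrder.
Variables (R : realType) (H : hilbertType R).
Implicit Types (x y z : H) (c : R) (A B C S : bop H).

Lemma bop_addE A B x : (A + B) x = A x + B x. Proof. by []. Qed.
Lemma bop_oppE A x : (- A) x = - A x. Proof. by []. Qed.
Lemma bop_mulE A B x : (A * B) x = A (B x). Proof. by []. Qed.
Lemma bop_scaleE (k : R[i]) A x : (k *: A) x = k *: A x. Proof. by []. Qed.
Lemma bop_oneE x : (1 : bop H) x = x. Proof. by []. Qed.
Lemma bop_zeroE x : (0 : bop H) x = 0. Proof. by []. Qed.

Lemma bop_mulZl (k : R[i]) A B : (k *: A) * B = k *: (A * B).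
Proof. exact: bop_ext. Qed.

Lemma bop_mulZr (k : R[i]) A B : A * (k *: B) = k *: (A * B).
Proof. by apply: bop_ext => x; exact: bopZ. Qed.

Lemma qfD A B x : qf (A + B) x = qf A x + qf B x.
Proof. by rewrite /qf bop_addE ripDl. Qed.

Lemma qfN A x : qf (- A) x = - qf A x.
Proof. by rewrite /qf bop_oppE ripNl. Qed.

Lemma qfZ c A x : qf (c%:C *: A) x = c * qf A x.
Proof. by rewrite /qf bop_scaleE ripZl. Qed.

Lemma qf1 x : qf 1 x = nr x ^+ 2.
Proof. exact: ripxx. Qed.

Lemma qf0 x : qf 0 x = 0.
Proof. by rewrite /qf bop_zeroE rip0l. Qed.

Lemma qf_scalar c x : qf (scalar_op H c) x = c * nr x ^+ 2.
Proof. by rewrite qfZ qf1. Qed.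

Lemma selfadj_rip A : selfadj A -> forall x y, rip (A x) y = rip x (A y).
Proof. by move=> sA x y; rewrite /rip sA. Qed.

Lemma selfadjD A B : selfadj A -> selfadj B -> selfadj (A + B).
Proof. by move=> sA sB x y; rewrite !bop_addE innerDl innerDr sA sB. Qed.

Lemma selfadjN A : selfadj A -> selfadj (- A).
Proof. by move=> sA x y; rewrite !bop_oppE innerNl innerNr sA. Qed.

Lemma selfadjB A B : selfadj A -> selfadj B -> selfadj (A - B).
Proof. by move=> sA sB; apply: selfadjD => //; apply: selfadjN. Qed.

Lemma selfadjZ c A : selfadj A -> selfadj (c%:C *: A).
Proof.
move=> sA x y; rewrite !bop_scaleE innerZl innerZr sA conj_Creal //.
by apply/complex_realP; exists c.
Qed.

Lemma selfadj1 : selfadj (1 : bop H). Proof. by []. Qed.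

Lemma selfadj0 : selfadj (0 : bop H).
Proof. by rewrite -(subrr 1); apply: selfadjB; exact: selfadj1. Qed.

Lemma selfadj_scalar c : selfadj (scalar_op H c).
Proof. exact/selfadjZ/selfadj1. Qed.

Lemma selfadjM A B : selfadj A -> selfadj B -> A * B = B * A -> selfadj (A * B).
Proof. by move=> sA sB AB x y; rewrite bop_mulE sA sB -bop_mulE -AB. Qed.

Lemma selfadj_cong S A : selfadj S -> selfadj A -> selfadj (S * A * S).
Proof. by move=> sS sA x y; rewrite !bop_mulE sS sA sS. Qed.

Lemma selfadjX A n : selfadj A -> selfadj (A ^+ n).
Proof.
move=> sA; elim: n => [|n IH]; first exact: selfadj1.
by rewrite exprS; apply: selfadjM => //; rewrite -exprS -exprSr.
Qed.

Lemma selfadj_sum (I : Type) (s : seq I) (F : I -> bop H) :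
  (forall i, selfadj (F i)) -> selfadj (\sum_(i <- s) F i).
Proof.
move=> sF; elim: s => [|i s IH]; first by rewrite big_nil; exact: selfadj0.
by rewrite big_cons; exact: selfadjD.
Qed.

Lemma op_le_qf A B : op_le A B -> forall x, qf A x <= qf B x.
Proof. by move=> /positiveP[_ AB] x; rewrite -subr_ge0 -qfN -qfD. Qed.

Lemma qf_op_le A B : selfadj A -> selfadj B ->
  (forall x, qf A x <= qf B x) -> op_le A B.
Proof.
move=> sA sB AB; apply/positiveP; split; first exact: selfadjB.
by move=> x; rewrite qfD qfN subr_ge0.
Qed.

Lemma positive_le0 A : positive A <-> op_le 0 A.
Proof. by rewrite /op_le subr0. Qed.

Lemma positive_qf A x : positive A -> 0 <= qf A x.
Proof. by move=> /positiveP[]. Qed.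

Lemma positive0 : positive (0 : bop H).
Proof. by apply/positiveP; split=> [|x]; [exact: selfadj0|rewrite qf0]. Qed.

Lemma positiveD A B : positive A -> positive B -> positive (A + B).
Proof.
move=> /positiveP[sA A0] /positiveP[sB B0]; apply/positiveP.
by split=> [|x]; [exact: selfadjD|rewrite qfD addr_ge0].
Qed.

Lemma positiveZ c A : 0 <= c -> positive A -> positive (c%:C *: A).
Proof.
move=> c0 /positiveP[sA A0]; apply/positiveP.
by split=> [|x]; [exact: selfadjZ|rewrite qfZ mulr_ge0].
Qed.

Lemma positive_scalar c : 0 <= c -> positive (scalar_op H c).
Proof.
move=> c0; apply: positiveZ => //; apply/positiveP; split=> [|x]; first exact: selfadj1.
by rewrite qf1 sqr_ge0.
Qed.

Lemma op_le_refl A : op_le A A.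
Proof. by rewrite /op_le subrr; exact: positive0. Qed.

Lemma op_le_trans B A C : op_le A B -> op_le B C -> op_le A C.
Proof.
by move=> AB BC; have := positiveD BC AB; rewrite addrA subrK.
Qed.

Lemma op_leD A B C D : op_le A B -> op_le C D -> op_le (A + C) (B + D).
Proof. by move=> AB CD; have := positiveD AB CD; rewrite addrACA -opprD. Qed.

Lemma op_leZ c A B : 0 <= c -> op_le A B -> op_le (c%:C *: A) (c%:C *: B).
Proof. by move=> c0 AB; have := positiveZ c0 AB; rewrite scalerBr. Qed.

Lemma op_le_sum n (F G : 'I_n -> bop H) :
  (forall i, op_le (F i) (G i)) -> op_le (\sum_i F i) (\sum_i G i).
Proof.
by move=> FG; elim/big_ind2: _ => // *; [exact: op_le_refl|exact: op_leD].
Qed.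

Lemma positive_le A B : positive A -> op_le A B -> positive B.
Proof. by move=> A0 AB; have := positiveD AB A0; rewrite subrK. Qed.

Lemma op_le_selfadj A B : selfadj A -> op_le A B -> selfadj B.
Proof.
by move=> sA /positive_selfadj sBA; have := selfadjD sBA sA; rewrite subrK.
Qed.

Lemma positive_cong S A : selfadj S -> positive A -> positive (S * A * S).
Proof.
move=> sS /positiveP[sA A0]; apply/positiveP; split; first exact: selfadj_cong.
by move=> x; rewrite /qf !bop_mulE (selfadj_rip sS); apply: A0.
Qed.

Lemma op_le_cong S A B : selfadj S -> op_le A B -> op_le (S * A * S) (S * B * S).
Proof.
by move=> sS AB; have := positive_cong sS AB; rewrite mulrBr mulrBl.
Qed.

(** The Cauchy-Schwarz inequality of the semi-inner product given by A, from the nonnegative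
    quadratic t |-> <A(x + ty), x + ty>. *)
Lemma positive_CS A x y : positive A -> rip (A x) y ^+ 2 <= qf A x * qf A y.
Proof.
move=> /positiveP[sA A0].
have P t : 0 <= qf A x + 2 * t * rip (A x) y + t ^+ 2 * qf A y.
  have := A0 (x + t%:C *: y); rewrite /qf bopD bopZ !ripDl !ripDr !ripZl !ripZr.
  rewrite (selfadj_rip sA y x) (ripC y) => /le_trans; apply.
  by rewrite le_eqVlt; apply/orP; left; apply/eqP; ring.
move: (A0 x) (A0 y) P; set a := qf A x; set b := qf A y; set d := rip _ _.
move=> a0 b0 P.
have [b00|bN0] := eqVneq b 0.
  have [->|dN0] := eqVneq d 0; first by rewrite b00 expr0n mulr0.
  (* With b = 0 the quadratic is affine in t; this t makes it equal to -1. *)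
  have := P (- (a + 1) / (2 * d)); rewrite b00 mulr0 addr0.
  have -> : a + 2 * (- (a + 1) / (2 * d)) * d = -1 by field.
  by rewrite ler0N1.
have b_gt0 : 0 < b by rewrite lt_def bN0.
(* The minimizer of the quadratic. *)
have := P (- d / b).
have -> : a + 2 * (- d / b) * d + (- d / b) ^+ 2 * b = (a * b - d ^+ 2) / b by field.
by rewrite pmulr_lge0 ?invr_gt0 // subr_ge0.
Qed.

Lemma rip_CS x y : rip x y <= nr x * nr y.
Proof.
have P1 : positive (1 : bop H).
  by apply/positiveP; split=> [|z]; [exact: selfadj1|rewrite qf1 sqr_ge0].
have := positive_CS x y P1; rewrite !qf1 bop_oneE -exprMn => h.
have h0 : 0 <= nr x * nr y by rewrite mulr_ge0 ?nr_ge0.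
rewrite -(ger0_norm h0); apply: le_trans (ler_norm _) _.
by rewrite -ler_sqr ?nnegrE // !real_normK ?num_real.
Qed.

Lemma norm_rip_CS x y : `|rip x y| <= nr x * nr y.
Proof. by rewrite ler_norml rip_CS lerNl -ripNl (le_trans (rip_CS _ _)) ?nrN. Qed.

Lemma bop_bound A : exists2 c, 0 < c & forall x, nr (A x) <= c * nr x.
Proof.
have [c cP] := bop_bounded A; exists (`|c| + 1) => [|x]; first exact: ltr_wpDl.
have := cP x; rewrite !nrE -rmorphM lecR => /le_trans; apply.
by rewrite ler_wpM2r ?nr_ge0 // (le_trans (ler_norm _)) // lerDl.
Qed.

Lemma opnorm_le_nr A c : opnorm_le A c <-> forall x, nr (A x) <= c * nr x.
Proof.
by split=> h x; have := h x; rewrite !nrE -rmorphM lecR.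
Qed.

Lemma op_bounds A : selfadj A ->
  exists2 c, 0 < c & op_le (scalar_op H (- c)) A /\ op_le A (scalar_op H c).
Proof.
move=> sA; have [c c0 cP] := bop_bound A; exists c => //.
have h x : qf A x <= c * nr x ^+ 2.
  by rewrite (le_trans (rip_CS _ _)) // expr2 mulrA ler_wpM2r ?nr_ge0.
have h' x : - qf A x <= c * nr x ^+ 2.
  rewrite /qf -ripNl (le_trans (rip_CS _ _)) // expr2 mulrA nrN.
  by rewrite ler_wpM2r ?nr_ge0.
split; apply: qf_op_le => //; try exact: selfadj_scalar.
  by move=> x; rewrite qf_scalar mulNr lerNl.
by move=> x; rewrite qf_scalar.
Qed.

(** A vector form of A^2 <= cA: apply Cauchy-Schwarz for A to x and Ax, bound <A(Ax), Ax> by c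
    |Ax|^2, and divide by |Ax|^2. It is what turns control of quadratic forms into control of
    norms. *)
Lemma positive_nr_bound A c x : positive A -> op_le A (scalar_op H c) ->
  nr (A x) ^+ 2 <= c * qf A x.
Proof.
move=> A0 Ac; have := positive_CS x (A x) A0; rewrite ripxx => h.
have h2 := op_le_qf Ac (A x); rewrite qf_scalar in h2.
have := le_trans h (ler_wpM2l (positive_qf x A0) h2).
have [->|nN0] := eqVneq (nr (A x)) 0.
  move=> _; rewrite expr0n /=; case: (ltP c 0) => c0; last by rewrite mulr_ge0 // positive_qf.
  have := op_le_qf Ac x; rewrite qf_scalar.
  have q0 := positive_qf x A0 => q1.
  have : c * nr x ^+ 2 <= 0 by rewrite mulr_le0_ge0 ?sqr_ge0 // ltW.
  move=> /(le_trans q1) q2; have -> : qf A x = 0 by apply/eqP; rewrite eq_le q2 q0.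
  by rewrite mulr0.
have n0 : 0 < nr (A x) ^+ 2 by rewrite exprn_gt0 // lt_def nN0 nr_ge0.
move: n0; move: (nr _ ^+ 2) => u u0.
by rewrite expr2 mulrA ler_pM2r // [qf A x * _]mulrC.
Qed.

(* Riesz: for 0 <= X <= 1 the iteration X_(n+1) = X_n - X_n ^ 2 decomposes X as
   a sum of squares commuting with B, plus X_n, which tends strongly to 0. *)
Lemma positive_comm_mul A B : positive A -> positive B -> A * B = B * A ->
  positive (A * B).
Proof.
move=> A0 B0 AB.
have [c c0 [_ Ac]] := op_bounds (positive_selfadj A0).
pose X := c^-1%:C *: A.
have XAc : A = c%:C *: X.
  by rewrite /X scalerA -rmorphM mulfV ?gt_eqF //= scale1r.
have X0 : positive X by apply: positiveZ => //; rewrite invr_ge0 ltW.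
have X1 : op_le X 1.
  have ci0 : 0 <= c^-1 by rewrite invr_ge0 ltW.
  have := op_leZ ci0 Ac.
  by rewrite /scalar_op scalerA -rmorphM mulVf ?gt_eqF //= scale1r.
have XB : X * B = B * X by rewrite /X bop_mulZl AB bop_mulZr.
suff : positive (X * B) by move=> /(positiveZ (ltW c0)); rewrite -bop_mulZl -XAc.
pose s n := iter n (fun Y : bop H => Y - Y * Y) X.
have sS n : s n.+1 = s n - s n * s n by [].
have sP n : [/\ positive (s n), op_le (s n) 1 & s n * B = B * s n].
  elim: n => [//|n [p0 p1 pB]]; have sp := positive_selfadj p0.
  have ss : selfadj (s n.+1) by rewrite sS; apply/selfadjB => //; apply: selfadjM.
  have qE x : qf (s n.+1) x = qf (s n) x - nr (s n x) ^+ 2.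
    by rewrite sS qfD qfN /qf bop_mulE (selfadj_rip sp (s n x)) ripxx.
  split.
  - apply/positiveP; split=> // x; rewrite qE subr_ge0.
    have := @positive_nr_bound (s n) 1 x p0; rewrite mul1r; apply.
    by rewrite /scalar_op scale1r.
  - apply: qf_op_le => // x; rewrite qE (le_trans _ (op_le_qf p1 x)) //.
    by rewrite gerBl sqr_ge0.
  - by rewrite sS mulrBl mulrBr -mulrA pB !mulrA pB.
apply/positiveP; split.
  by apply: selfadjM => //; exact: positive_selfadj.
move=> x; rewrite leNgt; apply/negP => q_lt0.
have sB n := selfadj_rip (positive_selfadj B0) n.
(* Each iteration lowers [s n * B] by [s n * B * s n], which is positive. *)
have lower n : qf (s n * B) x <= qf (X * B) x.
  elim: n => [//|n IH]; apply: le_trans IH.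
  rewrite sS mulrBl qfD qfN gerBl /qf -mulrA; have [p0 _ ->] := sP n.
  rewrite mulrA !bop_mulE (selfadj_rip (positive_selfadj p0)).
  exact: positive_qf.
have sumE n : \sum_(k < n) nr (s k x) ^+ 2 <= qf X x.
  have -> : \sum_(k < n) nr (s k x) ^+ 2 = qf X x - qf (s n) x.
    elim: n => [|n IH]; first by rewrite big_ord0 subrr.
    rewrite big_ord_recr IH -[nat_of_ord ord_max]/n sS qfD qfN /qf bop_mulE.
    have [p0 _ _] := sP n.
    rewrite (selfadj_rip (positive_selfadj p0) (s n x)) ripxx opprB addrA.
    exact: addrAC.
  by rewrite gerBl; apply: positive_qf; have [] := sP n.
(* If [d] > 0, every |s_n x| is at least d / |Bx|, whereas the squares |s_k x|^2 have partial sums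
   bounded by <Xx, x>. *)
set d := - qf (X * B) x.
have d0 : 0 < d by rewrite oppr_gt0.
have dle n : d <= nr (s n x) * nr (B x).
  rewrite lerNl (le_trans _ (lower n)) // lerNl.
  have [p0 _ _] := sP n.
  rewrite /qf bop_mulE (selfadj_rip (positive_selfadj p0)) ripC -ripNl.
  by rewrite (le_trans (rip_CS _ _)) // nrN.
have Bx0 : 0 < nr (B x).
  rewrite lt_def nr_ge0 andbT; apply/negP => /eqP e.
  by have := dle 0; rewrite e mulr0 leNgt d0.
pose e := (d / nr (B x)) ^+ 2.
have e0 : 0 < e by rewrite exprn_gt0 // divr_gt0.
have ele n : e <= nr (s n x) ^+ 2.
  have q0 : 0 <= d / nr (B x) by rewrite ltW // divr_gt0.
  by rewrite ler_sqr ?nnegrE ?nr_ge0 // ler_pdivrMr.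
pose n := Num.truncn (qf X x / e).
have := sumE n.+1; rewrite leNgt => /negP; apply.
have : n.+1%:R * e <= \sum_(k < n.+1) nr (s k x) ^+ 2.
  rewrite mulr_natl -[n.+1 in leLHS]card_ord -sumr_const.
  by apply: ler_sum => k _.
by apply: lt_le_trans; rewrite -ltr_pdivrMr // truncnS_gt.
Qed.

End OperatorOrder.

(** * Approximation by polynomials *)

Section NonnegativePolynomials.
Variable R : realType.
Implicit Types (p q : {poly R}) (a b t u v z : R).

(** Continuity fills in the point [z]. It serves for quotients by a linear factor, whose sign is
    directly known only away from the root divided out. *)
Lemma horner_ge0_closure a b z p : a < b ->
  (forall t, a <= t <= b -> t != z -> 0 <= p.[t]) ->
  forall t, a <= t <= b -> 0 <= p.[t].
Proof.
move=> ab p0 t /andP[ta tb]; have [tz|] := eqVneq t z; last first.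
  by apply: p0; rewrite ta tb.
rewrite leNgt; apply/negP => pt0.
have ept : 0 < - p.[t] by rewrite oppr_gt0.
have [d d0 dP] := polyrcf.poly_cont t p ept.
have [s [sab sz sd]] : exists s, [/\ a <= s <= b, s != z & `|s - t| < d].
  have [tltb|] := ltP t b.
    exists (Num.min b (t + d / 2)); split.
    - by rewrite ge_min lexx /= le_min (le_trans ta (ltW tltb)) /=; lra.
    - rewrite gt_eqF // lt_min; lra.
    - rewrite ger0_norm ?subr_ge0 ?le_min; last by lra.
      by rewrite ltrBlDr gt_min; apply/orP; right; lra.
  move=> bt; exists (Num.max a (t - d / 2)); split.
  - rewrite le_max lexx /= ge_max (ltW ab) /=; lra.
  - rewrite lt_eqF // gt_max; lra.
  - rewrite distrC ger0_norm ?subr_ge0 ?ge_max; last by lra.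
    by rewrite ltrBlDr -ltrBlDl lt_max; apply/orP; right; lra.
have := dP s sd; have := p0 s sab sz; rewrite ltr_norml => ? /andP[_]; lra.
Qed.

(** The quadratic is the real polynomial with roots z and its conjugate. The remainder of [p] modulo
    it is real, of degree at most one, and vanishes at the nonreal z, so it is zero. *)
Lemma root_conj_factor p (z : R[i]) : complex.Im z != 0 ->
  root (map_poly (real_complex R) p) z ->
  exists q, p = q * (('X - (complex.Re z)%:P) ^+ 2 + (complex.Im z ^+ 2)%:P).
Proof.
set u := complex.Re z; set v := complex.Im z => v0 /eqP rz.
pose d : {poly R} := ('X - u%:P) ^+ 2 + (v ^+ 2)%:P.
have sd : size d = 3%N.
  rewrite size_polyDl size_exp_XsubC //.
  by rewrite (leq_ltn_trans (size_polyC_leq1 _)).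
have dz : (map_poly (real_complex R) d).[z] = 0.
  rewrite rmorphD rmorphXn rmorphB /= map_polyX !map_polyC /= !hornerE.
  rewrite /u /v; case: (z) => x y /=; apply/eqP; rewrite eq_complex /=.
  by apply/andP; split; apply/eqP; ring.
have szr : (size (p %% d)%R <= 2)%N.
  by rewrite -ltnS -sd ltn_modp -size_poly_eq0 sd.
have r0 : p %% d = 0.
  have : (map_poly (real_complex R) (p %% d)).[z] = 0.
    move: rz; rewrite {1}(divp_eq p d) rmorphD rmorphM /= hornerD hornerM dz.
    by rewrite mulr0 add0r.
  have -> : p %% d = ((p %% d)`_1)%:P * 'X + ((p %% d)`_0)%:P.
    apply/polyP => i; rewrite coefD coefMX !coefC.
    case: i => [|[|i]] /=; rewrite ?add0r ?addr0 //.
    by rewrite nth_default // (leq_trans szr).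
  rewrite rmorphD rmorphM /= map_polyX !map_polyC /= !hornerE.
  move: v0; rewrite /v; case: (z) => x y /= y0 /eqP.
  rewrite eq_complex /= => /andP[/eqP e1 /eqP e2].
  have c1 : (p %% d)`_1 = 0.
    have : (p %% d)`_1 * y = 0 by move: e2; rewrite mul0r !addr0.
    by move=> /eqP; rewrite mulf_eq0 (negPf y0) orbF => /eqP.
  have c0 : (p %% d)`_0 = 0 by move: e1; rewrite c1; lra.
  by rewrite c1 c0 !polyC0 mul0r addr0.
by exists (p %/ d); rewrite {1}(divp_eq p d) r0 addr0.
Qed.

(** A root of [p] is nonreal, outside the open interval, or inside it; in each case one of the
    listed factors splits off and leaves a smaller polynomial still nonnegative on [a, b]. *)
Lemma nonneg_poly_ind a b (P : {poly R} -> Prop) : a < b ->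
  (forall c, 0 <= c -> P c%:P) ->
  (forall p z, z <= a -> P p -> P (p * ('X - z%:P))) ->
  (forall p z, b <= z -> P p -> P (p * (z%:P - 'X))) ->
  (forall p u v, P p -> P (p * (('X - u%:P) ^+ 2 + (v ^+ 2)%:P))) ->
  forall p, (forall t, a <= t <= b -> 0 <= p.[t]) -> P p.
Proof.
move=> ab PC Pa Pb Pq p; have [n] := ubnP (size p).
elim: n => [//|n IH] in p *; rewrite ltnS => szp p0.
have mid : a <= (a + b) / 2 <= b by apply/andP; split; lra.
have [p1|p1] := leqP (size p) 1.
  have := p0 _ mid; rewrite [p]size1_polyC // hornerC; exact: PC.
have pN0 : p != 0 by rewrite -size_poly_gt0 (leq_trans _ p1).
have IHq q k : p = q * k -> (1 < size k)%N ->
    (forall t, a <= t <= b -> 0 <= q.[t]) -> P q.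
  move=> pqk sk; apply: IH; rewrite (leq_trans _ szp) // pqk.
  move: pN0; rewrite pqk mulf_eq0 negb_or => /andP[qN0 kN0].
  rewrite size_mul //; case: (size k) sk => [//|[//|s]] _.
  by rewrite !addnS /= ltnS leq_addr.
have [z rz] : exists z : R[i], root (map_poly (real_complex R) p) z.
  by apply/closed_rootP; rewrite size_map_poly neq_ltn p1 orbT.
have [z0|zN0] := eqVneq (complex.Im z) 0; last first.
  have [q pE] := root_conj_factor zN0 rz.
  rewrite pE; apply/Pq/(IHq _ _ pE).
    by rewrite size_polyDl size_exp_XsubC // (leq_ltn_trans (size_polyC_leq1 _)).
  move=> t /p0; rewrite pE hornerM => h.
  rewrite -(@pmulr_lge0 _ (('X - (complex.Re z)%:P) ^+ 2 + (complex.Im z ^+ 2)%:P).[t]) //.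
  by rewrite !hornerE ltr_wpDl ?sqr_ge0 // exprn_even_gt0.
move: rz; have -> : z = (complex.Re z)%:C by case: (z) z0 => x y /= ->.
set x := complex.Re z; rewrite /root horner_map /= fmorph_eq0 -/(root p x).
move=> /factor_theorem[q pE].
have szX : size ('X - x%:P) = 2 by rewrite size_XsubC.
have [xa|ax] := leP x a.
  rewrite pE; apply: Pa => //; apply: (IHq _ _ pE); first by rewrite szX.
  apply: (@horner_ge0_closure _ _ a) => // t /andP[ta tb] ta'.
  have := p0 t; rewrite ta tb pE hornerM !hornerE => /(_ isT).
  have : a < t by rewrite lt_def ta'.
  by move=> ?; rewrite pmulr_lge0 //; lra.
have [bx|xb] := leP b x.
  have pE' : p = (- q) * (x%:P - 'X) by rewrite pE mulNr -mulrN opprB.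
  rewrite pE'; apply: Pb => //; apply: (IHq _ _ pE').
    by rewrite -opprB size_polyN szX.
  apply: (@horner_ge0_closure _ _ b) => // t /andP[ta tb] tb'.
  have := p0 t; rewrite ta tb pE' hornerM [(x%:P - 'X).[t]]hornerE !hornerE => /(_ isT).
  have : t < b by rewrite lt_def eq_sym tb'.
  by move=> ?; rewrite pmulr_lge0 //; lra.
(* An interior root is at least double: the quotient is nonnegative to its right and nonpositive to
   its left, so it vanishes there too, and the factor has v = 0. *)
have q_ge0 t : x <= t <= b -> 0 <= q.[t].
  apply: (@horner_ge0_closure _ _ x) => // {}t /andP[tx tb] tx'.
  have := p0 t; rewrite tb (le_trans (ltW ax) tx) pE hornerM !hornerE => /(_ isT).
  have : x < t by rewrite lt_def tx'.
  by move=> ?; rewrite pmulr_lge0 //; lra.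
have q_le0 t : a <= t <= x -> 0 <= (- q).[t].
  apply: (@horner_ge0_closure _ _ x) => // {}t /andP[ta tx] tx'.
  have := p0 t; rewrite ta (le_trans tx (ltW xb)) pE hornerM !hornerE => /(_ isT).
  have : t < x by rewrite lt_def eq_sym tx'.
  by move=> ?; rewrite nmulr_lge0 ?oppr_ge0 //; lra.
have : root q x.
  have h1 := q_ge0 x; have h2 := q_le0 x.
  rewrite lexx (ltW xb) in h1; rewrite lexx (ltW ax) in h2.
  move: (h1 isT) (h2 isT); rewrite hornerN => ? ?.
  by apply/eqP; lra.
move=> /factor_theorem[q2 qE].
have pE2 : p = q2 * (('X - x%:P) ^+ 2 + (0 ^+ 2)%:P).
  by rewrite pE qE expr0n addr0 -mulrA.
rewrite pE2; apply: Pq; apply: (IHq _ _ pE2).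
  by rewrite expr0n addr0 size_exp_XsubC.
apply: (@horner_ge0_closure _ _ x) => // t tab tx.
have := p0 t tab; rewrite pE2 hornerM !hornerE expr0n addr0.
by rewrite pmulr_lge0 // exprn_even_gt0 //= subr_eq0.
Qed.

End NonnegativePolynomials.

(** * Weierstrass approximation by Bernstein polynomials *)

Section Weierstrass.
Variable R : realType.
Implicit Types (a b t s e x : R) (f : R -> R).

(** Continuity is two-sided even at the endpoints, which suits functions continuous on (0, oo) and
    segments with a > 0. *)
Definition cont_seg (a b : R) f := forall t, a <= t <= b -> {for t, continuous f}.

Lemma cont_segP a b f t e : cont_seg a b f -> a <= t <= b -> 0 < e ->
  exists2 d, 0 < d & forall s, `|s - t| < d -> `|f s - f t| < e.
Proof.
move=> cf /cf /cvgrPdist_lt /(_ e) h e0; move/nbhs_ballP : (h e0) => [d /= d0 dP].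
exists d => // s st; rewrite distrC; apply: dP.
by rewrite /ball /= distrC.
Qed.

Lemma cont_seg_bounded a b f : cont_seg a b f ->
  exists2 c, 0 < c & forall t, a <= t <= b -> `|f t| <= c.
Proof.
move=> cf; have := @segment_compact R a b.
move/compact_near_coveringP => /(_ R (pinfty_nbhs R) (fun c t => `|f t| <= c)).
move=> /(_ _)[] //.
  move=> t; rewrite /= in_itv /= => tab.
  have [d d0 dP] := cont_segP cf tab ltr01.
  exists ([set s | `|s - t| < d], [set c | `|f t| + 1 < c]) => /=.
    split; last by exists (`|f t| + 1); split; rewrite ?num_real.
    by exists d => //= s; rewrite /ball /= distrC.
  move=> [s c] /= [/dP st tc]; rewrite (le_trans _ (ltW tc)) // -lerBlDl.
  by rewrite (le_trans _ (ltW st)) // (le_trans _ (ler_dist_dist _ _)) // ler_norm.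
move=> M [_ MP]; exists (`|M| + 1); first exact: ltr_wpDl.
move=> t tab; apply: (MP (`|M| + 1)); last by rewrite /= in_itv.
by rewrite (le_lt_trans (ler_norm _)) // ltrDl.
Qed.

Lemma cont_seg_uniform a b f e : cont_seg a b f -> 0 < e ->
  exists2 d, 0 < d & forall t s, a <= t <= b -> `|s - t| < d -> `|f s - f t| < e.
Proof.
move=> cf e0; have := @segment_compact R a b.
move/compact_near_coveringP => /(_ R (0^'+)
  (fun d t => forall s, `|s - t| < d -> `|f s - f t| < e)).
move=> /(_ _)[] //.
  move=> t; rewrite /= in_itv /= => tab.
  have e2 : 0 < e / 2 by rewrite divr_gt0.
  have [d d0 dP] := cont_segP cf tab e2.
  exists ([set s | `|s - t| < d / 2], [set c | c < d / 2]) => /=.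
    split; last by apply: nbhs_right_lt; rewrite divr_gt0.
    by exists (d / 2); rewrite /= ?divr_gt0 // => s; rewrite /ball /= distrC.
  move=> [s c] /= [st cd] u us.
  have h1 := dP s _; have h2 := dP u _.
  have ut : `|u - t| < d.
    have -> : u - t = (u - s) + (s - t) by ring.
    by rewrite (le_lt_trans (ler_normD _ _)) //; move: us st cd; lra.
  have {}st : `|s - t| < d by move: st; lra.
  have -> : f u - f s = (f u - f t) - (f s - f t) by ring.
  by rewrite (le_lt_trans (ler_normB _ _)) //; move: (h1 st) (h2 ut); lra.
move=> d /= d0 dP; exists (d / 2); first by rewrite divr_gt0.
move=> t s tab; apply: dP => /=.
- rewrite /ball_ /= sub0r normrN gtr0_norm ?divr_gt0 //; lra.
- by rewrite divr_gt0.
- by rewrite in_itv.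
Qed.

(** Where uniform continuity does not apply, |s - t| >= d and the bound 2M on the oscillation is at
    most (2M / d^2) (s - t)^2. A quadratic modulus can be averaged exactly under the binomial
    law. *)
Lemma cont_seg_quad a b f e : cont_seg a b f -> 0 < e ->
  exists2 c, 0 < c & forall t s, a <= t <= b -> a <= s <= b ->
    `|f s - f t| <= e + c * (s - t) ^+ 2.
Proof.
move=> cf e0; have [M M0 MP] := cont_seg_bounded cf.
have [d d0 dP] := cont_seg_uniform cf e0.
have c0 : 0 < 2 * M / d ^+ 2 by rewrite divr_gt0 ?exprn_gt0 // mulr_gt0.
exists (2 * M / d ^+ 2) => // t s tab sab.
have [/(dP _ _ tab) /ltW h|h] := ltP `|s - t| d.
  by rewrite (le_trans h) // lerDl mulr_ge0 ?sqr_ge0 // ltW.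
apply: (@le_trans _ _ (2 * M)).
  by rewrite (le_trans (ler_normB _ _)) //; move: (MP _ tab) (MP _ sab); lra.
rewrite -[leLHS]add0r lerD ?(ltW e0) // -mulrA ler_pMr ?mulr_gt0 //.
rewrite mulrC ler_pdivlMr ?exprn_gt0 // mul1r.
by rewrite -[leRHS]real_normK ?num_real // ler_sqr ?nnegrE ?normr_ge0 // (ltW d0).
Qed.

(* The Bernstein polynomial of degree n: the expectation of [phi] under the
   binomial law with parameter 'X, computed by conditioning on one trial. *)
Fixpoint bernstein (n : nat) (phi : nat -> R) : {poly R} :=
  if n is k.+1 then (1 - 'X) * bernstein k phi + 'X * bernstein k (phi \o S)
  else (phi 0%N)%:P.

Lemma bernsteinS n (phi : nat -> R) x : (bernstein n.+1 phi).[x] =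
  (1 - x) * (bernstein n phi).[x] + x * (bernstein n (phi \o S)).[x].
Proof. by rewrite /= hornerD !hornerM !hornerE. Qed.

Lemma bernstein_le n (phi psi : nat -> R) x : 0 <= x <= 1 ->
  (forall k, (k <= n)%N -> phi k <= psi k) ->
  (bernstein n phi).[x] <= (bernstein n psi).[x].
Proof.
move=> /andP[x0 x1]; elim: n => [|n IH] in phi psi *.
  by move=> h; rewrite /= !hornerC; apply: h.
move=> h; rewrite !bernsteinS lerD // ler_wpM2l ?subr_ge0 //; apply: IH => k kn.
  by apply: h; rewrite ltnW.
exact: h.
Qed.

(** The second moment of the binomial law about [d]: variance plus squared bias. Conditioning on a
    success shifts [d] to d - 1. *)
Lemma bernstein_quad n (c0 c1 d : R) x :
  (bernstein n (fun k => c0 + c1 * (k%:R - d) ^+ 2)).[x] =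
  c0 + c1 * (n%:R * x * (1 - x) + (n%:R * x - d) ^+ 2).
Proof.
elim: n => [|n IH] in d *; first by rewrite /= hornerC; ring.
rewrite bernsteinS IH.
have -> : (fun k => c0 + c1 * (k%:R - d) ^+ 2) \o S =
          (fun k => c0 + c1 * (k%:R - (d - 1)) ^+ 2).
  by apply/funext => k /=; rewrite -natr1; ring.
by rewrite IH -natr1; ring.
Qed.

Lemma bernstein_const n (c x : R) : (bernstein n (fun=> c)).[x] = c.
Proof.
have := bernstein_quad n c 0 0 x.
by rewrite mul0r addr0 => {2}<-; congr (bernstein _ _).[_]; apply/funext => k; rewrite mul0r addr0.
Qed.

Lemma bernsteinB n (phi psi : nat -> R) x :
  (bernstein n (fun k => phi k - psi k)).[x] =
  (bernstein n phi).[x] - (bernstein n psi).[x].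
Proof.
elim: n => [|n IH] in phi psi *; first by rewrite /= !hornerC.
rewrite !bernsteinS IH -[(fun k => phi k - psi k) \o S]/(fun k => (phi \o S) k - (psi \o S) k).
by rewrite IH; ring.
Qed.

Lemma weierstrass01 f e : cont_seg 0 1 f -> 0 < e ->
  exists p : {poly R}, forall t, 0 <= t <= 1 -> `|p.[t] - f t| <= e.
Proof.
move=> cf e0; have e20 : 0 < e / 2 by rewrite divr_gt0.
have [c c0 cP] := cont_seg_quad cf e20.
(* The averaged error is e/2 + c t(1 - t)/n, so c/n <= e/2 suffices. *)
pose n := (Num.truncn (c / (e / 2))).+1.
have n0 : 0 < n%:R :> R by rewrite ltr0n.
have cn : c / n%:R <= e / 2.
  rewrite ler_pdivrMr // mulrC -ler_pdivrMr //; apply: ltW; exact: truncnS_gt.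
pose phi (k : nat) := f (k%:R / n%:R).
exists (bernstein n phi) => t /[dup] t01 /andP[t0 t1].
rewrite -[f t](bernstein_const n _ t) -bernsteinB.
pose psi (k : nat) : R := e / 2 + c / n%:R ^+ 2 * (k%:R - n%:R * t) ^+ 2.
have bnd k : (k <= n)%N -> `|phi k - f t| <= psi k.
  move=> kn; apply: le_trans (cP _ _ t01 _) _.
    by rewrite divr_ge0 ?ler0n // ler_pdivrMr // mul1r ler_nat.
  rewrite /psi lerD2l le_eqVlt; apply/orP; left; apply/eqP.
  by field; rewrite gt_eqF.
have Epsi : (bernstein n psi).[t] <= e.
  rewrite bernstein_quad subrr expr0n addr0.
  have -> : c / n%:R ^+ 2 * (n%:R * t * (1 - t)) = c / n%:R * (t * (1 - t)).
    by field; rewrite gt_eqF.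
  have : t * (1 - t) <= 1 by nra.
  have : 0 <= c / n%:R by rewrite divr_ge0 ?ltW.
  by move: cn; nra.
rewrite ler_norml; apply/andP; split; last first.
  apply: le_trans Epsi; apply: bernstein_le => // k /bnd.
  by apply: le_trans; exact: ler_norm.
rewrite lerNl -sub0r -(bernstein_const n 0 t) -bernsteinB.
apply: le_trans Epsi; apply: bernstein_le => // k /bnd.
by apply: le_trans; rewrite sub0r -normrN ler_norm.
Qed.

Lemma weierstrass a b f e : a < b -> cont_seg a b f -> 0 < e ->
  exists p : {poly R}, forall t, a <= t <= b -> `|p.[t] - f t| <= e.
Proof.
move=> ab cf e0; pose g x := f (a + (b - a) * x).
have ba0 : 0 < b - a by rewrite subr_gt0.
have cg : cont_seg 0 1 g.
  move=> x /andP[x0 x1]; apply: (@continuous_comp _ _ _ (fun x => a + (b - a) * x) f).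
    apply: cvgD; first exact: cvg_cst.
    by apply: cvgM; [exact: cvg_cst|exact: cvg_id].
  by apply: cf; apply/andP; split; nra.
have [p pP] := weierstrass01 cg e0.
exists (p \Po ((b - a)^-1 *: ('X - a%:P))) => t /andP[ta tb].
rewrite horner_comp !hornerE.
have -> : f t = g ((b - a)^-1 * (t - a)).
  by rewrite /g mulrA mulfV ?gt_eqF // mul1r addrC subrK.
apply: pP; rewrite mulr_ge0 ?invr_ge0 ?subr_ge0 ?(ltW ab) //=.
by rewrite mulrC ler_pdivrMr // mul1r lerB.
Qed.

End Weierstrass.

(** * Functional calculus *)

Section OperatorPolynomials.
Variables (R : realType) (H : hilbertType R).
Implicit Types (x y z : H) (a b c e : R) (A B C S : bop H) (p q : {poly R}).

Lemma bop_fun0 A : A 0 = 0.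
Proof. by have := bopZ A 0 0; rewrite !scale0r. Qed.

Lemma op_poly_widen n p A : (size p <= n)%N ->
  op_poly p A = \sum_(i < n) (p`_i)%:C *: A ^+ i.
Proof.
move=> sp; rewrite /op_poly (big_ord_widen n (fun i => (p`_i)%:C *: A ^+ i)) //.
rewrite big_mkcond /=; apply: eq_bigr => i _; case: ltnP => // h.
by rewrite nth_default // rmorph0 scale0r.
Qed.

Lemma op_polyD p q A : op_poly (p + q) A = op_poly p A + op_poly q A.
Proof.
pose n := maxn (size p) (size q).
rewrite !(@op_poly_widen n) ?leq_maxl ?leq_maxr ?size_polyD //.
by rewrite -big_split; apply: eq_bigr => i _; rewrite coefD rmorphD scalerDl.
Qed.

Lemma op_polyZ c p A : op_poly (c *: p) A = c%:C *: op_poly p A.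
Proof.
rewrite !(@op_poly_widen (size p)) ?size_scale_leq // scaler_sumr.
by apply: eq_bigr => i _; rewrite coefZ rmorphM scalerA.
Qed.

Lemma op_polyN p A : op_poly (- p) A = - op_poly p A.
Proof. by rewrite -scaleN1r op_polyZ rmorphN1 scaleN1r. Qed.

Lemma op_polyB p q A : op_poly (p - q) A = op_poly p A - op_poly q A.
Proof. by rewrite op_polyD op_polyN. Qed.

Lemma op_polyC c A : op_poly c%:P A = scalar_op H c.
Proof.
by rewrite (@op_poly_widen 1) ?size_polyC_leq1 // big_ord1 coefC eqxx expr0.
Qed.

Lemma op_polyMX p A : op_poly (p * 'X) A = op_poly p A * A.
Proof.
rewrite (@op_poly_widen (size p).+1); last first.
  by rewrite (leq_trans (size_polyMleq _ _)) // size_polyX addn2.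
rewrite big_ord_recl coefMX /= rmorph0 scale0r add0r /op_poly mulr_suml.
by apply: eq_bigr => i _; rewrite coefMX /= exprSr bop_mulZl.
Qed.

Lemma op_polyX A : op_poly 'X A = A.
Proof.
by rewrite -['X]mul1r op_polyMX op_polyC /scalar_op scale1r mul1r.
Qed.

Lemma op_polyM p q A : op_poly (p * q) A = op_poly p A * op_poly q A.
Proof.
elim/poly_ind: q => [|q c IH].
  by rewrite mulr0 /op_poly size_poly0 !big_ord0 mulr0.
rewrite mulrDr mulrA !op_polyD !op_polyMX mulrDr IH mulrA; congr (_ + _).
rewrite mulrC mul_polyC op_polyZ op_polyC /scalar_op bop_mulZr.
by rewrite mulr1.
Qed.

Lemma op_poly_comm p q A : op_poly p A * op_poly q A = op_poly q A * op_poly p A.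
Proof. by rewrite -!op_polyM mulrC. Qed.

Lemma selfadj_op_poly p A : selfadj A -> selfadj (op_poly p A).
Proof. by move=> sA; apply: selfadj_sum => i; apply/selfadjZ/selfadjX. Qed.

Lemma op_poly_eigen p A v (l : R) : A v = l%:C *: v ->
  op_poly p A v = (p.[l])%:C *: v.
Proof.
move=> Av; elim/poly_ind: p => [|p c IH].
  by rewrite /op_poly size_poly0 big_ord0 bop_zeroE horner0 scale0r.
rewrite op_polyD op_polyMX op_polyC bop_addE bop_mulE Av bopZ IH !hornerE.
by rewrite scalerA rmorphD rmorphM scalerDl mulrC.
Qed.

Definition op_between a b A := op_le (scalar_op H a) A /\ op_le A (scalar_op H b).

Lemma op_between_selfadj a b A : op_between a b A -> selfadj A.
Proof. by move=> [aA _]; apply: op_le_selfadj aA; exact: selfadj_scalar. Qed.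

Lemma op_between_qf a b A x : op_between a b A ->
  a * nr x ^+ 2 <= qf A x <= b * nr x ^+ 2.
Proof. by move=> [h k]; rewrite -!qf_scalar !op_le_qf. Qed.

Lemma op_between_trivial a b A : b < a -> op_between a b A -> forall x, x = 0.
Proof.
move=> ba Aab x; apply: nr_eq0; have /andP[h k] := op_between_qf x Aab.
have := le_trans h k; rewrite -subr_ge0 -mulrBl nmulr_rge0 ?subr_lt0 // => h2.
by apply/eqP; rewrite -sqrf_eq0 eq_le h2 sqr_ge0.
Qed.

(** Induction over the factorization: each factor is positive at A and commutes with the rest. The
    quadratic factor is split into a congruence by A - u and a multiple by v^2. *)
Lemma op_poly_ge0_lt p a b A : a < b -> op_between a b A ->
  (forall t, a <= t <= b -> 0 <= p.[t]) -> positive (op_poly p A).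
Proof.
move=> ab Aab; have sA := op_between_selfadj Aab; case: Aab => aA Ab.
move: p; apply: (nonneg_poly_ind ab) => [c c0|p z za p0|p z bz p0|p u v p0].
- by rewrite op_polyC; apply: positive_scalar.
- rewrite op_polyM; apply: positive_comm_mul => //; last exact: op_poly_comm.
  rewrite op_polyB op_polyX op_polyC.
  apply: op_le_trans aA; rewrite /op_le /scalar_op -scalerBl -rmorphB.
  by apply: positive_scalar; rewrite subr_ge0.
- rewrite op_polyM; apply: positive_comm_mul => //; last exact: op_poly_comm.
  rewrite op_polyB op_polyX op_polyC.
  apply: op_le_trans Ab _; rewrite /op_le /scalar_op -scalerBl -rmorphB.
  by apply: positive_scalar; rewrite subr_ge0.
rewrite mulrDr op_polyD; apply: positiveD; last first.
  by rewrite mulrC mul_polyC op_polyZ; apply: positiveZ; rewrite ?sqr_ge0.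
rewrite expr2 mulrCA mulrA !op_polyM; apply: positive_cong => //.
exact: selfadj_op_poly.
Qed.

(** The degenerate intervals remain: b < a forces the zero space, and a = b forces A = aI. *)
Lemma op_poly_ge0 p a b A : op_between a b A ->
  (forall t, a <= t <= b -> 0 <= p.[t]) -> positive (op_poly p A).
Proof.
move=> Aab p0; have [ab|ba|ab] := ltgtP a b; first exact: op_poly_ge0_lt p0.
  move=> x; rewrite (op_between_trivial ba Aab x); by rewrite bop_fun0 inner0l.
have -> : A = scalar_op H a.
  apply: bop_ext => x; apply/eqP; rewrite -subr_eq0; apply/eqP/nr_eq0.
  have P0 : positive (A - scalar_op H a) by case: Aab.
  have := @positive_nr_bound _ _ _ 0 x P0; rewrite mul0r /op_le.
  have -> : scalar_op H 0 - (A - scalar_op H a) = scalar_op H b - A.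
    by rewrite /scalar_op scale0r sub0r opprB ab.
  move=> /(_ Aab.2) h; apply/eqP; rewrite -sqrf_eq0 eq_le sqr_ge0 andbT.
  exact: h.
have -> : op_poly p (scalar_op H a) = scalar_op H p.[a].
  by apply: bop_ext => x; rewrite (@op_poly_eigen _ _ _ a).
by apply: positive_scalar; apply: p0; rewrite lexx ab /=.
Qed.

(** Positivity of e^2 - p^2 at A reads |p(A)x|^2 <= e^2 |x|^2. Uniform approximation of functions
    thus becomes norm approximation of operators. *)
Lemma op_poly_norm p a b A e : op_between a b A -> 0 <= e ->
  (forall t, a <= t <= b -> `|p.[t]| <= e) -> opnorm_le (op_poly p A) e.
Proof.
move=> Aab e0 pe; apply/opnorm_le_nr => x.
have sA := op_between_selfadj Aab.
have : positive (op_poly ((e ^+ 2)%:P - p * p) A).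
  apply: op_poly_ge0 Aab _ => t /pe h.
  rewrite !hornerE subr_ge0 -expr2 -[leLHS]real_normK ?num_real //.
  by rewrite ler_sqr ?nnegrE.
move=> /(positive_qf x); rewrite op_polyB op_polyC op_polyM qfD qfN qf_scalar.
rewrite /qf bop_mulE (selfadj_rip (selfadj_op_poly p sA)) ripxx subr_ge0.
by rewrite -exprMn ler_sqr // nnegrE ?mulr_ge0 ?nr_ge0.
Qed.

End OperatorPolynomials.

Section Limits.
Variables (R : realType) (H : hilbertType R).
Implicit Types (u : nat -> H) (l x : H) (e c : R).

Lemma cvgH_unique u l l' : u k @[k --> \oo] --> l -> u k @[k --> \oo] --> l' -> l = l'.
Proof. exact: (cvg_unique (@norm_hausdorff _ H)). Qed.

Lemma gtc0_real (k : R[i]) : 0 < k -> exists2 e, 0 < e & k = e%:C.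
Proof.
move=> k0; exists (complex.Re k); last by rewrite RRe_real // gtr0_real.
by move: k0; rewrite ltcE => /andP[].
Qed.

Lemma cvg_nrP u l : u k @[k --> \oo] --> l <->
  forall e, 0 < e -> exists N, forall k, (N <= k)%N -> nr (l - u k) <= e.
Proof.
split=> [/cvgrPdist_le h e e0|h].
  have /h [N _ NP] : 0 < (e%:C : R[i]) by rewrite ltcE /= eqxx.
  by exists N => k /NP; rewrite /= nrE lecR.
apply/cvgrPdist_le => _ /gtc0_real[e /h[N NP] ->].
by exists N => // k /NP; rewrite /= nrE lecR.
Qed.

Lemma cauchy_nr_cvg u :
  (forall e, 0 < e -> exists N, forall i j, (N <= i)%N -> (N <= j)%N ->
     nr (u i - u j) <= e) -> exists l, u k @[k --> \oo] --> l.
Proof.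
move=> h; apply/cvg_ex; apply: cauchy_cvg; apply/cauchy_ballP => _ /gtc0_real[e e0 ->].
have e20 : 0 < e / 2 by rewrite divr_gt0.
have [N NP] := h _ e20.
exists (u @` [set k | (N <= k)%N], u @` [set k | (N <= k)%N]) => /=.
  by split; exists N => // k /= Nk; exists k.
move=> [x y] /= [[i Ni <-] [j Nj <-]].
rewrite -ball_normE /= nrE ltcR (le_lt_trans (NP _ _ Ni Nj)) //.
by move: e20; lra.
Qed.

Lemma cvg_nr_le u l c : u k @[k --> \oo] --> l ->
  (exists N, forall k, (N <= k)%N -> nr (u k) <= c) -> nr l <= c.
Proof.
move=> /cvg_nrP ul [N NP]; apply/ler_addgt0Pr => e /ul[M MP].
have hM := MP (maxn N M) (leq_maxr _ _).
have hN := NP (maxn N M) (leq_maxl _ _).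
have -> : l = u (maxn N M) + (l - u (maxn N M)) by rewrite addrC subrK.
by rewrite (le_trans (nrD _ _)) // lerD.
Qed.

Lemma op_limit (T : nat -> bop H) c :
  (forall k x, nr (T k x) <= c * nr x) ->
  (forall x, exists l, T k x @[k --> \oo] --> l) -> exists B, sot_cvg T B.
Proof.
move=> Tc Tl; pose F x := projT1 (cid (Tl x)).
have FP x : T k x @[k --> \oo] --> F x by rewrite /F; case: cid.
have Flin : linear F.
  move=> k x y; apply: cvgH_unique (FP _) _.
  have E i : T i (k *: x + y) = k *: T i x + T i y by exact: bop_linear.
  rewrite /= (eq_cvg _ _ E).
  by apply: cvgD => //; apply: cvgZr.
have Fb : exists c : R, forall x, `|F x| <= c%:C * `|x|.
  exists c => x; rewrite !nrE -rmorphM lecR.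
  by apply: cvg_nr_le (FP x) _; exists 0%N => k _.
by exists (Bop Flin Fb) => x; exact: FP.
Qed.

Lemma sot_cvg_unique (T : nat -> bop H) B C : sot_cvg T B -> sot_cvg T C -> B = C.
Proof. by move=> TB TC; apply: bop_ext => x; apply: cvgH_unique (TB x) (TC x). Qed.

End Limits.

(** * Existence, uniqueness and rules of the continuous functional calculus *)

Section FunctionalCalculus.
Variables (R : realType) (H : hilbertType R).
Implicit Types (x y z v : H) (a b c e l t : R) (A B C : bop H) (p q : {poly R}).
Implicit Types (f g : R -> R).

Definition calc_approx a b f A B := forall e, 0 < e -> exists p,
  (forall t, a <= t <= b -> `|p.[t] - f t| <= e) /\ opnorm_le (op_poly p A - B) e.

(** The real part determines the inner product, since Im <x, y> = Re <x, iy>. *)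
Lemma rip_selfadj A : (forall x y, rip (A x) y = rip x (A y)) -> selfadj A.
Proof.
move=> sA; have ImE x y : complex.Im (inner x y) = rip x ('i%C *: y).
  by rewrite /rip innerZr; case: (inner x y) => u v /=; rewrite ?oppr0; ring.
move=> x y; apply/eqP; rewrite eq_complex; apply/andP; split; apply/eqP.
  exact: sA.
by rewrite !ImE sA bopZ.
Qed.

Lemma opnorm_sub0 B C : (forall e, 0 < e -> opnorm_le (B - C) e) -> B = C.
Proof.
move=> h; apply: bop_ext => x; apply/eqP; rewrite -subr_eq0; apply/eqP/nr_eq0.
apply/eqP; rewrite eq_le nr_ge0 andbT; apply/ler_addgt0Pr => e e0; rewrite add0r.
have e1 : 0 < e / (nr x + 1) by rewrite divr_gt0 // ltr_wpDl ?nr_ge0.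
have /opnorm_le_nr/(_ x) := h _ e1; move=> /le_trans; apply.
rewrite mulrAC ler_pdivrMr ?ltr_wpDl ?nr_ge0 //.
by rewrite ler_wpM2l // ?(ltW e0) // lerDl.
Qed.

Lemma opnorm_leD B C c e : opnorm_le B c -> opnorm_le C e -> opnorm_le (B + C) (c + e).
Proof.
move=> /opnorm_le_nr hB /opnorm_le_nr hC; apply/opnorm_le_nr => x.
by rewrite (le_trans (nrD _ _)) // mulrDl lerD.
Qed.

Lemma opnorm_leN B c : opnorm_le B c -> opnorm_le (- B) c.
Proof. by move=> h x; rewrite bop_oppE normrN. Qed.

Lemma opnorm_leW B c e : c <= e -> opnorm_le B c -> opnorm_le B e.
Proof.
move=> ce /opnorm_le_nr h; apply/opnorm_le_nr => x; rewrite (le_trans (h x)) //.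
by rewrite ler_wpM2r // nr_ge0.
Qed.

Lemma opnorm_leM B C c e : 0 <= c ->
  opnorm_le B c -> opnorm_le C e -> opnorm_le (B * C) (c * e).
Proof.
move=> c0 /opnorm_le_nr hB /opnorm_le_nr hC; apply/opnorm_le_nr => x.
by rewrite (le_trans (hB _)) // -mulrA ler_wpM2l.
Qed.

Lemma op_between_meet a b a' b' A : op_between a b A -> op_between a' b' A ->
  op_between (Num.max a a') (Num.min b b') A.
Proof.
move=> [h1 h2] [h3 h4]; split.
  by rewrite /Num.max; case: ifP.
by rewrite /Num.min; case: ifP.
Qed.

(** [is_fun_calc] leaves the interval open. Two approximating polynomials, each good on its own
    interval, are compared on the intersection, which still brackets A. *)
Lemma calc_approx_unique a b a' b' f A B C :
  op_between a b A -> op_between a' b' A ->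
  calc_approx a b f A B -> calc_approx a' b' f A C -> B = C.
Proof.
move=> Aab Aab' hB hC; apply: opnorm_sub0 => e e0.
have e4 : 0 < e / 4 by rewrite divr_gt0.
have [p [pf pB]] := hB _ e4; have [q [qf' qC]] := hC _ e4.
have -> : B - C = (op_poly (p - q) A - (op_poly p A - B)) + (op_poly q A - C).
  rewrite op_polyB; move: (op_poly p A) (op_poly q A) => P Q.
  by rewrite opprB [in RHS](addrC (P - Q)) !subrKA.
have -> : e = (e / 2 + e / 4) + e / 4 by field.
apply: opnorm_leD => //; apply: opnorm_leD; last exact: opnorm_leN.
apply: (op_poly_norm (op_between_meet Aab Aab')); first by rewrite divr_ge0 ?ltW.
move=> t; rewrite ge_max le_min => /andP[/andP[h1 h2] /andP[h3 h4]].
have := pf t; rewrite h1 h3 => /(_ isT); have := qf' t; rewrite h2 h4 => /(_ isT).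
rewrite !hornerE => k1 k2.
have -> : p.[t] - q.[t] = (p.[t] - f t) - (q.[t] - f t) by ring.
by rewrite (le_trans (ler_normB _ _)) //; move: k1 k2; lra.
Qed.

Lemma fun_calcE a b f A B : op_between a b A -> calc_approx a b f A B ->
  fun_calc f A = B.
Proof.
move=> Aab AB; rewrite /fun_calc; case: xgetP => [C _ [a' [b' [h1 h2 h3]]]|].
  exact: calc_approx_unique h3 AB.
by move=> /(_ B) []; exists a, b; case: Aab.
Qed.

(** Polynomials within 1/(k+1) of f give operators that are Cauchy in norm by [op_poly_norm]. Their
    pointwise limit is a bounded operator, and the uniform estimate passes to it. *)
Lemma calc_approx_exists a b f A : a <= b -> op_between a b A -> cont_seg a b f ->
  exists B, calc_approx a b f A B.
Proof.
move=> ab Aab cf.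
have W e : 0 < e -> exists p, forall t, a <= t <= b -> `|p.[t] - f t| <= e.
  move=> e0; move: ab; rewrite le_eqVlt => /predU1P[ab|ab]; last exact: weierstrass.
  exists (f a)%:P => t; rewrite -ab => /le_anti <-.
  by rewrite hornerC subrr normr0 ltW.
have W' k : exists p, forall t, a <= t <= b -> `|p.[t] - f t| <= k.+1%:R^-1.
  by apply: W; rewrite invr_gt0.
pose P k := projT1 (cid (W' k)).
have PP k t : a <= t <= b -> `|(P k).[t] - f t| <= k.+1%:R^-1.
  by rewrite /P; case: cid => p /= ; apply.
have inv_small e : 0 < e -> exists N, forall k, (N <= k)%N -> k.+1%:R^-1 <= e.
  move=> e0; exists (Num.truncn e^-1) => k kN.
  rewrite invf_ple ?posrE // ltW // (lt_le_trans (truncnS_gt _)) //.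
  by rewrite ler_nat ltnS.
have PPd i j e : i.+1%:R^-1 <= e -> j.+1%:R^-1 <= e ->
    opnorm_le (op_poly (P i) A - op_poly (P j) A) (e + e).
  move=> ie je; rewrite -op_polyB; have e0 : 0 <= e.
    by rewrite (le_trans _ ie) // invr_ge0.
  apply: op_poly_norm Aab _ _; first exact: addr_ge0.
  move=> t tab; rewrite !hornerE.
  have -> : (P i).[t] - (P j).[t] = ((P i).[t] - f t) - ((P j).[t] - f t) by ring.
  rewrite (le_trans (ler_normB _ _)) // lerD //.
    exact: le_trans (PP i t tab) ie.
  exact: le_trans (PP j t tab) je.
have [c c0 cP] := bop_bound (op_poly (P 0%N) A).
have Tb k x : nr (op_poly (P k) A x) <= (2 + c) * nr x.
  have i1 j : j.+1%:R^-1 <= 1 :> R by rewrite invf_le1 ?ltr0n // ler1n.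
  have /opnorm_le_nr/(_ x) := PPd k 0%N 1 (i1 _) (i1 _).
  rewrite bop_addE bop_oppE => h.
  have -> : op_poly (P k) A x =
      (op_poly (P k) A x - op_poly (P 0%N) A x) + op_poly (P 0%N) A x by rewrite subrK.
  by rewrite (le_trans (nrD _ _)) // mulrDl lerD.
have [|B BP] := op_limit Tb.
  move=> x; apply: cauchy_nr_cvg => e e0.
  have e1 : 0 < e / (2 * (nr x + 1)) by rewrite divr_gt0 // mulr_gt0 // ltr_wpDl ?nr_ge0.
  have [N NP] := inv_small _ e1; exists N => i j Ni Nj.
  have /opnorm_le_nr/(_ x) := PPd i j _ (NP _ Ni) (NP _ Nj).
  move=> /le_trans; apply.
  have n0 : 0 < nr x + 1 by rewrite ltr_wpDl ?nr_ge0.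
  have -> : e / (2 * (nr x + 1)) + e / (2 * (nr x + 1)) = e / (nr x + 1).
    by field; rewrite gt_eqF.
  by rewrite mulrAC ler_pdivrMr // ler_wpM2l ?(ltW e0) // lerDl.
exists B => e e0; have e2 : 0 < e / 2 by rewrite divr_gt0.
have [N NP] := inv_small _ e2; exists (P N); split.
  by move=> t /(PP N) /le_trans; apply; rewrite (le_trans (NP _ (leqnn _))) //; lra.
apply/opnorm_le_nr => x; rewrite bop_addE bop_oppE.
have BN : (op_poly (P N) A x - op_poly (P k) A x) @[k --> \oo] --> op_poly (P N) A x - B x.
  by apply: cvgB; [exact: cvg_cst|exact: BP].
apply: cvg_nr_le BN _; exists N => k Nk.
have /opnorm_le_nr/(_ x) := PPd N k _ (NP _ (leqnn _)) (NP _ Nk).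
by have -> : e / 2 + e / 2 = e by field.
Qed.

Lemma fun_calcP a b f A : a <= b -> op_between a b A -> cont_seg a b f ->
  calc_approx a b f A (fun_calc f A).
Proof.
move=> ab Aab cf; have [B BP] := calc_approx_exists ab Aab cf.
by rewrite (fun_calcE Aab BP).
Qed.

Section OneOperator.
Variables (a b : R) (A : bop H).
Hypotheses (ab : a <= b) (Aab : op_between a b A).

Lemma fun_calc_poly p : fun_calc (horner p) A = op_poly p A.
Proof.
apply: (fun_calcE Aab) => e e0; exists p; split=> [t _|].
  by rewrite subrr normr0 ltW.
by rewrite subrr => x; rewrite bop_zeroE normr0 mulr_ge0 // lecR ltW.
Qed.

Lemma fun_calc_ext f g : (forall t, a <= t <= b -> f t = g t) -> cont_seg a b f ->
  fun_calc g A = fun_calc f A.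
Proof.
move=> fg cf; apply: (fun_calcE Aab) => e e0.
have [p [pf pA]] := fun_calcP ab Aab cf e0; exists p; split=> // t tab.
by rewrite -fg // pf.
Qed.

Lemma fun_calcD f g : cont_seg a b f -> cont_seg a b g ->
  fun_calc (fun t => f t + g t) A = fun_calc f A + fun_calc g A.
Proof.
move=> cf cg; apply: (fun_calcE Aab) => e e0.
have e2 : 0 < e / 2 by rewrite divr_gt0.
have [p [pf pA]] := fun_calcP ab Aab cf e2.
have [q [qg qA]] := fun_calcP ab Aab cg e2.
exists (p + q); have -> : e = e / 2 + e / 2 by field.
split=> [t tab|]; last by rewrite op_polyD opprD addrACA; exact: opnorm_leD.
rewrite hornerD opprD addrACA (le_trans (ler_normD _ _)) // lerD //; [exact: pf|exact: qg].
Qed.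

Lemma fun_calcM f g : cont_seg a b f -> cont_seg a b g ->
  fun_calc (fun t => f t * g t) A = fun_calc f A * fun_calc g A.
Proof.
move=> cf cg; apply: (fun_calcE Aab) => e e0.
have [c1 c10 c1P] := cont_seg_bounded cf; have [c2 c20 c2P] := cont_seg_bounded cg.
have [d1 d10 /opnorm_le_nr d1P] := bop_bound (fun_calc f A).
have [d2 d20 /opnorm_le_nr d2P] := bop_bound (fun_calc g A).
(* With both factors approximated within [k] <= 1, each of the two product errors, of functions and
   of operators, has three terms totalling at most [k * s]. *)
pose s := c1 + c2 + d1 + d2 + 1; have s0 : 0 < s by rewrite /s; lra.
pose k := Num.min 1 (e / s); have k0 : 0 < k by rewrite lt_min ltr01 divr_gt0.
have ks : k * s <= e by rewrite -ler_pdivlMr // ge_min lexx orbT.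
have k1 : k <= 1 by rewrite ge_min lexx.
have [p [pf pA]] := fun_calcP ab Aab cf k0.
have [q [qg qA]] := fun_calcP ab Aab cg k0.
exists (p * q); split=> [t tab|].
  rewrite hornerM.
  have -> : p.[t] * q.[t] - f t * g t = (p.[t] - f t) * (q.[t] - g t) +
     (p.[t] - f t) * g t + f t * (q.[t] - g t) by ring.
  rewrite (le_trans (ler_normD _ _)) // (le_trans (lerD (ler_normD _ _) (lexx _))) //.
  rewrite !normrM; move: (pf t tab) (qg t tab) (c1P t tab) (c2P t tab) ks k1.
  have := normr_ge0 (p.[t] - f t); have := normr_ge0 (q.[t] - g t).
  have := normr_ge0 (f t); have := normr_ge0 (g t); rewrite /s.
  move: `|p.[t] - f t| `|q.[t] - g t| `|f t| `|g t| => u v w z.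
  move=> z0 w0 v0 u0 uk vk wc zc ks' k1'.
  have h1 : u * v <= k * 1 by apply: ler_pM => //; exact: le_trans vk k1'.
  have h2 : u * z <= k * c2 by apply: ler_pM.
  have h3 : w * v <= c1 * k by apply: ler_pM.
  by nra.
set F := fun_calc f A in d1P pA *; set G := fun_calc g A in d2P qA *.
have -> : op_poly (p * q) A - F * G = (op_poly p A - F) * (op_poly q A - G) +
     (op_poly p A - F) * G + F * (op_poly q A - G).
  rewrite op_polyM; move: (op_poly p A) (op_poly q A) => P Q.
  by rewrite -mulrDr subrK mulrBl mulrBr addrA subrK.
apply: (@opnorm_leW _ (k * 1 + k * d2 + d1 * k)); first by move: ks; rewrite /s; nra.
apply: opnorm_leD; last by apply: opnorm_leM => //; exact: ltW.
apply: opnorm_leD; apply: opnorm_leM => //; try exact: ltW.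
exact: opnorm_leW qA.
Qed.

Lemma fun_calc_scalar c : fun_calc (fun=> c) A = scalar_op H c.
Proof.
rewrite -(op_polyC c A) -fun_calc_poly; congr fun_calc.
by apply/funext => t; rewrite hornerC.
Qed.

Lemma fun_calc_id : fun_calc id A = A.
Proof.
rewrite -{2}(op_polyX A) -fun_calc_poly; congr fun_calc.
by apply/funext => t; rewrite hornerX.
Qed.

Lemma cont_seg_cst c : cont_seg a b (fun=> c).
Proof. by move=> t _; exact: cvg_cst. Qed.

Lemma cont_segZ c f : cont_seg a b f -> cont_seg a b (fun t => c * f t).
Proof. by move=> cf t tab; apply: cvgM; [exact: cvg_cst|exact: cf]. Qed.

Lemma fun_calcZ c f : cont_seg a b f ->
  fun_calc (fun t => c * f t) A = c%:C *: fun_calc f A.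
Proof.
move=> cf; rewrite (@fun_calcM (fun=> c) f) //; last exact: cont_seg_cst.
by rewrite fun_calc_scalar /scalar_op bop_mulZl mul1r.
Qed.

Lemma fun_calc_selfadj f : cont_seg a b f -> selfadj (fun_calc f A).
Proof.
move=> cf; apply: rip_selfadj => x y; apply/eqP; rewrite -subr_eq0 -normr_eq0.
rewrite eq_le normr_ge0 andbT; apply/ler_addgt0Pr => e e0; rewrite add0r.
have n0 : 0 < nr x * nr y + 1 by rewrite ltr_wpDl // mulr_ge0 ?nr_ge0.
have e1 : 0 < e / (2 * (nr x * nr y + 1)) by rewrite divr_gt0 // mulr_gt0.
have [p [_ /opnorm_le_nr pA]] := fun_calcP ab Aab cf e1.
set d := e / _ in e1 pA.
have -> : e = 2 * d * (nr x * nr y + 1) by rewrite /d; field; rewrite gt_eqF.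
set F := fun_calc f A in pA *; set P := op_poly p A in pA.
have sP := selfadj_rip (selfadj_op_poly p (op_between_selfadj Aab)) x y.
have -> : rip (F x) y - rip x (F y) = rip x ((P - F) y) - rip ((P - F) x) y.
  by rewrite !bop_addE !bop_oppE ripDl ripDr ripNl ripNr sP; ring.
rewrite (le_trans (ler_normB _ _)) //.
have h1 := norm_rip_CS x ((P - F) y); have h2 := norm_rip_CS ((P - F) x) y.
have h3 := ler_wpM2l (nr_ge0 x) (pA y); have h4 := ler_wpM2r (nr_ge0 y) (pA x).
by nra.
Qed.

Lemma fun_calc_ge0 f : cont_seg a b f -> (forall t, a <= t <= b -> 0 <= f t) ->
  positive (fun_calc f A).
Proof.
move=> cf f0; apply/positiveP; split; first exact: fun_calc_selfadj.
move=> x; apply/ler_addgt0Pr => e e0.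
have e1 : 0 < e / (2 * (nr x ^+ 2 + 1)) by rewrite divr_gt0 // mulr_gt0 // ltr_wpDl ?sqr_ge0.
set d := e / _ in e1.
have [p [pf pA]] := fun_calcP ab Aab cf e1.
(* Raising the approximant by its own error [d] makes it nonnegative on [a, b]. *)
have P0 : positive (op_poly (p + d%:P) A).
  apply: op_poly_ge0 Aab _ => t tab; rewrite !hornerE.
  by have := pf t tab; have := f0 t tab; rewrite ler_norml => ? /andP[]; lra.
have := positive_qf x P0; rewrite op_polyD op_polyC qfD qf_scalar => h.
have : qf (op_poly p A - fun_calc f A) x <= d * nr x ^+ 2.
  move/opnorm_le_nr/(_ x): pA => pA.
  by rewrite (le_trans (rip_CS _ _)) // expr2 mulrA ler_wpM2r ?nr_ge0.
rewrite qfD qfN => h2.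
have -> : e = 2 * d * (nr x ^+ 2 + 1).
  by rewrite /d; field; rewrite gt_eqF // ltr_wpDl ?sqr_ge0.
by move: h h2 e1; lra.
Qed.

Lemma fun_calc_le f g : cont_seg a b f -> cont_seg a b g ->
  (forall t, a <= t <= b -> f t <= g t) -> op_le (fun_calc f A) (fun_calc g A).
Proof.
move=> cf cg fg; have cNf := @cont_segZ (-1) f cf.
have := @fun_calc_ge0 (fun t => g t + -1 * f t); rewrite fun_calcD // fun_calcZ //.
rewrite rmorphN1 scaleN1r; apply => [t tab|t tab].
  by apply: cvgD; [exact: cg|exact: cNf].
by rewrite mulN1r subr_ge0 fg.
Qed.

Lemma fun_calc_eigen f v l : cont_seg a b f -> a <= l <= b ->
  A v = l%:C *: v -> fun_calc f A v = (f l)%:C *: v.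
Proof.
move=> cf lab Av; apply/eqP; rewrite -subr_eq0; apply/eqP/nr_eq0.
apply/eqP; rewrite eq_le nr_ge0 andbT; apply/ler_addgt0Pr => e e0; rewrite add0r.
have n0 : 0 < nr v + 1 by rewrite ltr_wpDl ?nr_ge0.
have e1 : 0 < e / (2 * (nr v + 1)) by rewrite divr_gt0 // mulr_gt0.
have [p [pf /opnorm_le_nr/(_ v) pA]] := fun_calcP ab Aab cf e1.
have -> : fun_calc f A v - (f l)%:C *: v =
  - (op_poly p A - fun_calc f A) v + (p.[l] - f l)%:C *: v.
  by rewrite bop_addE bop_oppE (op_poly_eigen p Av) opprB rmorphB scalerBl addrA subrK.
rewrite (le_trans (nrD _ _)) // nrN nrZ.
have := ler_wpM2r (nr_ge0 v) (pf l lab).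
set u := nr _ in pA *; set w := `|_| * _ => h.
have -> : e = 2 * (e / (2 * (nr v + 1))) * (nr v + 1).
  by field; rewrite gt_eqF.
by move: h pA e1; lra.
Qed.

End OneOperator.

End FunctionalCalculus.

(** * Inverses and powers *)

Section PositiveInvertible.
Variables (R : realType) (H : hilbertType R).
Implicit Types (x y z v : H) (a b c r t : R) (A B C S : bop H) (f : R -> R).

Lemma continuous_powR r t : 0 < t -> {for t, continuous (fun s => s `^ r)}.
Proof.
move=> t0; apply: differentiable_continuous; apply/derivable1_diffP.
by apply: derivable_powR; rewrite in_itv /= t0.
Qed.

Lemma cont_seg_pow a b r : 0 < a -> cont_seg a b (fun t => t `^ r).
Proof. by move=> a0 t /andP[at_ _]; apply/continuous_powR/(lt_le_trans a0). Qed.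

Lemma cont_seg_inv a b : 0 < a -> cont_seg a b (@GRing.inv R).
Proof.
by move=> a0 t /andP[at_ _]; apply: inv_continuous; rewrite gt_eqF // (lt_le_trans a0).
Qed.

Lemma inverse_unique A B C : A * B = 1 -> C * A = 1 -> B = C.
Proof. by move=> AB CA; rewrite -[B]mul1r -CA -mulrA AB mulr1. Qed.

Lemma op_invP A : invertible A -> A * op_inv A = 1 /\ op_inv A * A = 1.
Proof.
move=> [B BP]; rewrite /op_inv; case: xgetP => [C _ []//|].
by move=> /(_ B) [].
Qed.

Lemma op_invE A B : A * B = 1 -> B * A = 1 -> op_inv A = B.
Proof.
move=> AB BA; have [h1 h2] : A * op_inv A = 1 /\ op_inv A * A = 1.
  by apply: op_invP; exists B.
exact: inverse_unique h1 BA.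
Qed.

Lemma mulr_op_inv A : posinv A -> A * op_inv A = 1.
Proof. by move=> [_ /op_invP[]]. Qed.

Lemma mull_op_inv A : posinv A -> op_inv A * A = 1.
Proof. by move=> [_ /op_invP[]]. Qed.

(** With B = A^-1 bounded by [c] and A <= bI: |x|^2 = |BAx|^2 <= c^2 |Ax|^2 <= c^2 b <Ax, x>, a
    positive lower bound for A. *)
Lemma posinv_between A : posinv A -> exists a b, [/\ 0 < a, a <= b & op_between a b A].
Proof.
move=> [A0 [B [AB BA]]]; have sA := positive_selfadj A0.
have [b b0 [_ Ab]] := op_bounds sA; have [c c0 cP] := bop_bound B.
(* The minimum secures a <= b even on the zero space. *)
pose a := Num.min b (b * c ^+ 2)^-1.
have bc0 : 0 < b * c ^+ 2 by rewrite mulr_gt0 // exprn_gt0.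
exists a, b; split; first by rewrite lt_min b0 invr_gt0.
  by rewrite ge_min lexx.
split=> //; apply: qf_op_le => //; first exact: selfadj_scalar.
move=> x; rewrite qf_scalar.
apply: (@le_trans _ _ ((b * c ^+ 2)^-1 * nr x ^+ 2)).
  by rewrite ler_wpM2r ?sqr_ge0 // ge_min lexx orbT.
rewrite mulrC ler_pdivrMr // mulrA.
have h := positive_nr_bound x A0 Ab.
apply: (@le_trans _ _ (c ^+ 2 * nr (A x) ^+ 2)).
  rewrite -exprMn ler_sqr ?nnegrE ?mulr_ge0 ?nr_ge0 ?(ltW c0) //.
  by have := cP (A x); rewrite -bop_mulE BA.
by rewrite mulrC ler_wpM2r ?sqr_ge0 // mulrC.
Qed.

Lemma op_between_inv a b A : 0 < a -> a <= b -> op_between a b A ->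
  posinv A /\ fun_calc (@GRing.inv R) A = op_inv A.
Proof.
move=> a0 ab Aab; have ci := @cont_seg_inv a b a0.
have cid : cont_seg a b id by move=> t _; exact: cvg_id.
have tN0 t : a <= t <= b -> t != 0.
  by move=> /andP[at_ _]; rewrite gt_eqF // (lt_le_trans a0).
have E1 : A * fun_calc (@GRing.inv R) A = 1.
  rewrite -{1}(fun_calc_id Aab) -(fun_calcM ab Aab) //.
  rewrite -[RHS](scale1r (1 : bop H)) -[RHS](@fun_calc_scalar _ _ _ _ _ Aab 1).
  apply: (fun_calc_ext ab Aab); last exact: cont_seg_cst.
  by move=> t /tN0 t0; rewrite mulfV.
have E2 : fun_calc (@GRing.inv R) A * A = 1.
  rewrite -{2}(fun_calc_id Aab) -(fun_calcM ab Aab) //.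
  rewrite -[RHS](scale1r (1 : bop H)) -[RHS](@fun_calc_scalar _ _ _ _ _ Aab 1).
  apply: (fun_calc_ext ab Aab); last exact: cont_seg_cst.
  by move=> t /tN0 t0; rewrite mulVf.
split; last by rewrite (op_invE E1 E2).
split; last by exists (fun_calc (@GRing.inv R) A).
case: Aab => aA _; apply: positive_le aA; apply: positive_scalar; exact: ltW.
Qed.

Lemma posinv_ge a A : 0 < a -> op_le (scalar_op H a) A -> posinv A.
Proof.
move=> a0 aA; have sA := op_le_selfadj (selfadj_scalar a) aA.
have [b b0 [_ Ab]] := op_bounds sA.
have ab : a <= a + b by rewrite lerDl ltW.
apply: (proj1 (op_between_inv a0 ab _)); split=> //.
apply: op_le_trans Ab _; rewrite /op_le /scalar_op -scalerBl -rmorphB addrK.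
by apply: positive_scalar; exact: ltW.
Qed.

Lemma posinv_le A B : posinv A -> op_le A B -> posinv B.
Proof.
move=> /posinv_between[a [b [a0 _ [aA _]]]] AB.
exact: posinv_ge a0 (op_le_trans aA AB).
Qed.

Lemma posinv_selfadj A : posinv A -> selfadj A.
Proof. by move=> [/positive_selfadj]. Qed.

Lemma op_inv_between a b A : 0 < a -> a <= b -> op_between a b A ->
  op_between b^-1 a^-1 (op_inv A).
Proof.
move=> a0 ab Aab; have [_ <-] := op_between_inv a0 ab Aab.
have b0 := lt_le_trans a0 ab.
split; rewrite -(@fun_calc_scalar _ _ _ _ _ Aab);
  apply: (fun_calc_le ab Aab); try exact: cont_seg_cst; try exact: cont_seg_inv.
- move=> t /andP[at_ tb]; rewrite lef_pV2 ?posrE //; exact: lt_le_trans at_.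
- move=> t /andP[at_ tb]; rewrite lef_pV2 ?posrE //; exact: lt_le_trans at_.
Qed.

Lemma posinv_inv A : posinv A -> posinv (op_inv A).
Proof.
move=> /posinv_between[a [b [a0 ab Aab]]].
have [h _] := op_inv_between a0 ab Aab; apply: posinv_ge h.
by rewrite invr_gt0 (lt_le_trans a0).
Qed.

Lemma op_invK A : posinv A -> op_inv (op_inv A) = A.
Proof. by move=> pA; apply: op_invE; [exact: mull_op_inv|exact: mulr_op_inv]. Qed.

(** With y = B^-1 x and z = A^-1 x, <B^-1 x, x>^2 = <Ay, z>^2 <= <Ay, y> <Az, z> <= <By, y> <A^-1 x,
    x>, and <By, y> = <B^-1 x, x> is divided out. *)
Lemma op_inv_le A B : posinv A -> op_le A B -> op_le (op_inv B) (op_inv A).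
Proof.
move=> pA AB; have pB := posinv_le pA AB.
have piA := posinv_inv pA; have piB := posinv_inv pB.
apply: qf_op_le => [||x]; try exact: posinv_selfadj.
set y := op_inv B x; set z := op_inv A x.
have Ex : rip (A y) z = rip y x.
  rewrite (selfadj_rip (posinv_selfadj pA)) /z -bop_mulE mulr_op_inv //.
have EA : qf A z = qf (op_inv A) x.
  by rewrite /qf /z -(bop_mulE A) mulr_op_inv // bop_oneE ripC.
have EB : qf B y = qf (op_inv B) x.
  by rewrite /qf /y -(bop_mulE B) mulr_op_inv // bop_oneE ripC.
have q0 : 0 <= qf (op_inv B) x by apply: positive_qf; case: piB.
have := positive_CS y z (proj1 pA); rewrite Ex EA.
have hy := op_le_qf AB y; rewrite EB in hy.
have k0 : 0 <= qf (op_inv A) x by apply: positive_qf; case: piA.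
rewrite -[rip y x]/(qf (op_inv B) x) => h.
have := le_trans h (ler_wpM2r k0 hy).
have [->//|n0] := eqVneq (qf (op_inv B) x) 0.
by rewrite expr2 ler_pM2l // lt_def n0.
Qed.

Lemma adjointE S : selfadj S -> adjoint S = S.
Proof.
move=> sS; rewrite /adjoint; case: xgetP => [B _ BP|].
  apply: bop_ext => y; apply/eqP; rewrite -subr_eq0; apply/eqP/nr_eq0.
  by apply/eqP; rewrite -sqrf_eq0 -ripxx /rip innerDr innerNr -BP sS subrr eqxx.
by move=> /(_ S) [].
Qed.

Lemma op_pow_mul a b A r s : 0 < a -> a <= b -> op_between a b A ->
  op_pow A r * op_pow A s = op_pow A (r + s).
Proof.
move=> a0 ab Aab; rewrite /op_pow -(fun_calcM ab Aab); try exact: cont_seg_pow.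
apply: (fun_calc_ext ab Aab); last exact: cont_seg_pow.
move=> t /andP[at_ _]; have t0 : t != 0 by rewrite gt_eqF // (lt_le_trans a0).
by rewrite powRD // t0 implybT.
Qed.

Lemma op_pow0 a b A : 0 < a -> a <= b -> op_between a b A -> op_pow A 0 = 1.
Proof.
move=> a0 ab Aab; rewrite -[RHS](scale1r (1 : bop H)) -[RHS](@fun_calc_scalar _ _ _ _ _ Aab 1).
by congr fun_calc; apply/funext => t; rewrite powRr0.
Qed.

Lemma op_pow1 a b A : 0 < a -> a <= b -> op_between a b A -> op_pow A 1 = A.
Proof.
move=> a0 ab Aab; rewrite -[RHS](fun_calc_id Aab).
apply: (fun_calc_ext ab Aab); last by move=> t _; exact: cvg_id.
by move=> t /andP[at_ _]; rewrite powRr1 // ltW // (lt_le_trans a0).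
Qed.

Lemma posinv_sqrt A : posinv A -> let S := op_pow A (1 / 2) in let T := op_pow A (- (1 / 2)) in
  [/\ selfadj S, selfadj T, S * S = A, S * T = 1 & T * S = 1] /\ T * T = op_inv A.
Proof.
move=> /posinv_between[a [b [a0 ab Aab]]] S T.
have sS : selfadj S by apply: (fun_calc_selfadj ab Aab); exact: cont_seg_pow.
have sT : selfadj T by apply: (fun_calc_selfadj ab Aab); exact: cont_seg_pow.
have SS : S * S = A.
  by rewrite (op_pow_mul _ _ a0 ab Aab) -splitr (op_pow1 a0 ab Aab).
have ST : S * T = 1 by rewrite (op_pow_mul _ _ a0 ab Aab) subrr (op_pow0 a0 ab Aab).
have TS : T * S = 1 by rewrite (op_pow_mul _ _ a0 ab Aab) addNr (op_pow0 a0 ab Aab).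
split=> //; symmetry; apply: op_invE.
  by rewrite -SS -mulrA (mulrA S T) ST mul1r ST.
by rewrite -SS -mulrA (mulrA T S) TS mul1r TS.
Qed.

End PositiveInvertible.

(** * The Hilbert space of dimension two *)

(** A separate name for the product, so that it can carry the Euclidean norm instead of the maximum
    norm of a pair. *)
Definition C2 (R : realType) : Type := (R[i] * R[i])%type.

Section C2.
Variable R : realType.
Local Notation C2 := (C2 R).
Implicit Types x y z : C2.

HB.instance Definition _ := GRing.Lmodule.copy C2 (R[i]^o * R[i]^o)%type.

Definition C2_inner x y : R[i] := x.1 * Num.conj y.1 + x.2 * Num.conj y.2.

Definition C2_norm x : R[i] := sqrtC (C2_inner x x).

Lemma C2_innerDl x y z : C2_inner (x + y) z = C2_inner x z + C2_inner y z.
Proof. by rewrite /C2_inner /= !mulrDl addrACA. Qed.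

Lemma C2_innerZl (c : R[i]) x y : C2_inner (c *: x) y = c * C2_inner x y.
Proof. by rewrite /C2_inner mulrDr !mulrA. Qed.

Lemma C2_inner_conj x y : C2_inner y x = Num.conj (C2_inner x y).
Proof.
by rewrite /C2_inner rmorphD !rmorphM /= !conjCK mulrC [y.2 * _]mulrC.
Qed.

Lemma C2_innerxx x : C2_inner x x = `|x.1| ^+ 2 + `|x.2| ^+ 2.
Proof. by rewrite /C2_inner !normCK. Qed.

Lemma C2_inner_ge0 x : 0 <= C2_inner x x.
Proof. by rewrite C2_innerxx addr_ge0 // exprn_ge0. Qed.

Lemma C2_norm_ge0 x : 0 <= C2_norm x.
Proof. by rewrite sqrtC_ge0 C2_inner_ge0. Qed.

Lemma C2_norm_sqr x : C2_norm x ^+ 2 = C2_inner x x.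
Proof. exact: sqrtCK. Qed.

(** Lagrange's identity: the gap between the squares is |x_1 y_2 - x_2 y_1|^2. *)
Lemma C2_CS x y : `|C2_inner x y| <= C2_norm x * C2_norm y.
Proof.
rewrite -ler_sqr ?nnegrE ?mulr_ge0 ?C2_norm_ge0 // exprMn !C2_norm_sqr normCK.
have -> : C2_inner x x * C2_inner y y = C2_inner x y * Num.conj (C2_inner x y)
    + `|x.1 * y.2 - x.2 * y.1| ^+ 2.
  by rewrite normCK /C2_inner rmorphB rmorphD !rmorphM /= !conjCK; ring.
by rewrite lerDl exprn_ge0.
Qed.

Lemma C2_normD x y : C2_norm (x + y) <= C2_norm x + C2_norm y.
Proof.
rewrite -ler_sqr ?nnegrE ?addr_ge0 ?C2_norm_ge0 // sqrrD !C2_norm_sqr.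
have C2_innerDr u v w : C2_inner u (v + w) = C2_inner u v + C2_inner u w.
  by rewrite C2_inner_conj C2_innerDl rmorphD /= -!C2_inner_conj.
rewrite C2_innerDl !C2_innerDr addrA lerD2r -addrA lerD2l (C2_inner_conj x y).
set z := C2_inner x y; rewrite mulr2n (le_trans _ (lerD (C2_CS x y) (C2_CS x y))) //.
have zr : z + Num.conj z \is Num.real by rewrite CrealE rmorphD /= conjCK addrC.
rewrite (le_trans (real_ler_norm zr)) // (le_trans (ler_normD _ _)) //.
by rewrite norm_conjC.
Qed.

Lemma C2_normZ (c : R[i]) x : C2_norm (c *: x) = `|c| * C2_norm x.
Proof.
apply/eqP; rewrite -(eqrXn2 (n := 2)) ?mulr_ge0 ?C2_norm_ge0 // exprMn !C2_norm_sqr.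
by rewrite !C2_innerxx !normrM !exprMn mulrDr.
Qed.

Lemma C2_norm0_eq0 x : C2_norm x = 0 -> x = 0.
Proof.
move=> /eqP; rewrite sqrtC_eq0 C2_innerxx paddr_eq0 ?exprn_ge0 //.
by rewrite !sqrf_eq0 !normr_eq0 => /andP[/eqP x1 /eqP x2]; case: x x1 x2 => /= ? ? -> ->.
Qed.

HB.instance Definition _ :=
  Lmodule_isNormed.Build R[i] C2 C2_normD C2_normZ C2_norm0_eq0.

Lemma C2_normE x : `|x| = C2_norm x. Proof. by []. Qed.

Lemma C2_norm1 x : `|x.1| <= `|x|.
Proof.
rewrite C2_normE -ler_sqr ?nnegrE ?C2_norm_ge0 // C2_norm_sqr C2_innerxx.
by rewrite lerDl exprn_ge0.
Qed.

Lemma C2_norm2 x : `|x.2| <= `|x|.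
Proof.
rewrite C2_normE -ler_sqr ?nnegrE ?C2_norm_ge0 // C2_norm_sqr C2_innerxx.
by rewrite lerDr exprn_ge0.
Qed.

Lemma C2_norm_le x : `|x| <= `|x.1| + `|x.2|.
Proof.
rewrite C2_normE -ler_sqr ?nnegrE ?addr_ge0 ?C2_norm_ge0 // C2_norm_sqr C2_innerxx.
by rewrite sqrrD lerD2r lerDl mulrn_wge0 // mulr_ge0.
Qed.

Lemma norm_Re_le (z : R[i]) : `|complex.Re z|%:C <= `|z|.
Proof. exact: normc_ge_Re. Qed.

Lemma norm_Im_le (z : R[i]) : `|complex.Im z|%:C <= `|z|.
Proof.
rewrite normc_def lecR -sqrtr_sqr ler_sqrt ?addr_ge0 ?sqr_ge0 //.
by rewrite lerDr sqr_ge0.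
Qed.

Lemma normc_le_ReIm (z : R[i]) : `|z| <= (`|complex.Re z| + `|complex.Im z|)%:C.
Proof.
rewrite {1}[z]complexE (le_trans (ler_normD _ _)) // rmorphD lerD //.
  by rewrite normc_def /= expr0n addr0 sqrtr_sqr.
rewrite normrM normc_def /= expr0n add0r expr1n sqrtr1 mul1r.
by rewrite normc_def /= expr0n addr0 sqrtr_sqr.
Qed.

Lemma C2_complete (F : set_system C2) : ProperFilter F -> cauchy F -> cvg F.
Proof.
move=> FF /cauchy_ballP Fc.
have lims (phi : C2 -> R) : (forall x y, `|phi x - phi y|%:C <= `|x - y|) ->
    exists l : R, phi x @[x --> F] --> l.
  move=> phiL; apply/cvg_ex; apply: cauchy_cvg; apply/cauchy_ballP => e e0.
  have ec0 : 0 < (e%:C : R[i]) by rewrite ltcE /= eqxx.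
  have [[P Q] /= [FP FQ] PQ] := Fc _ ec0.
  exists (phi @` P, phi @` Q) => /=.
    by split; [apply: filterS FP|apply: filterS FQ] => x Px; exists x.
  move=> [_ _] /= [[x Px <-] [y Qy <-]].
  have := PQ (x, y) (conj Px Qy); rewrite /= -ball_normE /= => h.
  by rewrite -ball_normE /= -ltcR; apply: le_lt_trans h.
have ReB (u v : R[i]) : complex.Re u - complex.Re v = complex.Re (u - v).
  by case: u v => [? ?] [? ?].
have ImB (u v : R[i]) : complex.Im u - complex.Im v = complex.Im (u - v).
  by case: u v => [? ?] [? ?].
have [|l1 h1] := lims (fun x => complex.Re x.1).
  by move=> x y; rewrite ReB (le_trans (norm_Re_le _)) // (C2_norm1 (x - y)).
have [|l2 h2] := lims (fun x => complex.Im x.1).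
  by move=> x y; rewrite ImB (le_trans (norm_Im_le _)) // (C2_norm1 (x - y)).
have [|l3 h3] := lims (fun x => complex.Re x.2).
  by move=> x y; rewrite ReB (le_trans (norm_Re_le _)) // (C2_norm2 (x - y)).
have [|l4 h4] := lims (fun x => complex.Im x.2).
  by move=> x y; rewrite ImB (le_trans (norm_Im_le _)) // (C2_norm2 (x - y)).
have dist_le (x : C2) : `|((l1 +i* l2, l3 +i* l4) : C2) - x| <=
    (`|l1 - complex.Re x.1| + `|l2 - complex.Im x.1|
     + (`|l3 - complex.Re x.2| + `|l4 - complex.Im x.2|))%:C.
  rewrite (le_trans (C2_norm_le _)) // [leRHS]rmorphD.
  by case: x => [[x1 x2] [x3 x4]]; apply: lerD; exact: normc_le_ReIm.
apply/cvg_ex; exists ((l1 +i* l2, l3 +i* l4) : C2); apply/cvgrPdist_le => e e0.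
have eE : e = (complex.Re e)%:C by rewrite RRe_real // gtr0_real.
have re0 : 0 < complex.Re e / 4.
  by rewrite divr_gt0 //; move: e0; rewrite ltcE => /andP[].
move/cvgrPdist_le : h1 => /(_ _ re0) h1; move/cvgrPdist_le : h2 => /(_ _ re0) h2.
move/cvgrPdist_le : h3 => /(_ _ re0) h3; move/cvgrPdist_le : h4 => /(_ _ re0) h4.
near=> x; rewrite (le_trans (dist_le x)) // eE lecR.
have k1 : `|l1 - complex.Re x.1| <= complex.Re e / 4 by near: x.
have k2 : `|l2 - complex.Im x.1| <= complex.Re e / 4 by near: x.
have k3 : `|l3 - complex.Re x.2| <= complex.Re e / 4 by near: x.
have k4 : `|l4 - complex.Im x.2| <= complex.Re e / 4 by near: x.
by move: k1 k2 k3 k4; lra.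
Unshelve. all: by end_near. Qed.

HB.instance Definition _ := Uniform_isComplete.Build C2 C2_complete.

Lemma C2_inner_norm x : C2_inner x x = `|x| ^+ 2.
Proof. by rewrite -C2_norm_sqr. Qed.

HB.instance Definition _ := isInnerProductSpace.Build R C2
  C2_innerDl C2_innerZl C2_inner_conj C2_inner_norm.

End C2.

Section Symmetric2x2.
Variable R : realType.
Local Notation C2 := (C2 R).
Implicit Types (x y z : C2) (a b c d e u v : R) (A B : bop C2).

Definition sym2_fun c d e x : C2 :=
  (c%:C * x.1 + d%:C * x.2, d%:C * x.1 + e%:C * x.2).

Lemma sym2_linear c d e : linear (sym2_fun c d e).
Proof.
move=> k [x1 x2] [y1 y2]; rewrite /sym2_fun /=.
by apply: (@pair_equal_spec _ _ _ _ _ _).2; split=> /=; rewrite /GRing.scale /=; ring.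
Qed.

Lemma sym2_bounded c d e : exists k : R, forall x, `|sym2_fun c d e x| <= k%:C * `|x|.
Proof.
exists (`|c| + `|d| + (`|d| + `|e|)) => x; rewrite (le_trans (C2_norm_le _)) //=.
have nC (k : R) : `|k%:C| = `|k|%:C :> R[i].
  by rewrite normc_def /= expr0n addr0 sqrtr_sqr.
have k0 (k : R) : 0 <= `|k|%:C :> R[i] by rewrite lecR.
rewrite !rmorphD !mulrDl; apply: lerD; rewrite (le_trans (ler_normD _ _)) //;
  apply: lerD; rewrite normrM nC ler_wpM2l // ?C2_norm1 ?C2_norm2 //.
Qed.

Definition sym2 c d e := Bop (sym2_linear c d e) (sym2_bounded c d e).

(** Completing the square in the first coordinate. *)
Lemma sym2_ge0 c d e : 0 < c -> d ^+ 2 <= c * e -> positive (sym2 c d e).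
Proof.
move=> c0 cde x; rewrite /inner /= /C2_inner /=; case: x => x1 x2 /=.
have cN0 : c%:C != 0 :> R[i] by rewrite eq_complex /= gt_eqF.
have cjR (k : R) : Num.conj (k%:C) = k%:C :> R[i].
  by rewrite conj_Creal //; apply/complex_realP; exists k.
have -> : (c%:C * x1 + d%:C * x2) * Num.conj x1 + (d%:C * x1 + e%:C * x2) * Num.conj x2 =
    c%:C * `|x1 + (d%:C / c%:C) * x2| ^+ 2 + (e - d ^+ 2 / c)%:C * `|x2| ^+ 2.
  have -> : (e - d ^+ 2 / c)%:C = e%:C - d%:C ^+ 2 / c%:C.
    by rewrite rmorphB fmorph_div rmorphXn.
  have cjdc : Num.conj (d%:C / c%:C : R[i]) = d%:C / c%:C by rewrite -fmorph_div; exact: cjR.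
  by rewrite !normCK (rmorphD Num.conj) (rmorphM Num.conj) /= cjdc; field.
apply: addr_ge0; apply: mulr_ge0; rewrite ?exprn_ge0 // lecR ?(ltW c0) //.
by rewrite subr_ge0 ler_pdivrMr // mulrC.
Qed.

Lemma sym2B c d e c' d' e' :
  sym2 c d e - sym2 c' d' e' = sym2 (c - c') (d - d') (e - e').
Proof.
apply: bop_ext => -[x1 x2]; apply: (@pair_equal_spec _ _ _ _ _ _).2.
by split; rewrite /= !rmorphB; ring.
Qed.

Lemma sym2_scalar c : sym2 c 0 c = scalar_op C2 c.
Proof.
apply: bop_ext => -[x1 x2]; apply: (@pair_equal_spec _ _ _ _ _ _).2.
by split; rewrite /= /GRing.scale /=; ring.
Qed.

Lemma rip_real c d c' d' :
  rip ((c%:C, d%:C) : C2) ((c'%:C, d'%:C) : C2) = c * c' + d * d'.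
Proof.
by rewrite /rip /inner /= /C2_inner /=; ring.
Qed.

(* The compression of a 2x2 matrix with eigenvalues [a], [b] to a unit vector
   is dominated by a diagonal matrix whose first entry exceeds the compression
   by [eps], at the price of a large second entry. *)
Lemma monotone_calculus_concave (T : bop C2 -> bop C2) (g : R -> R) :
  (forall A B, posinv A -> posinv B -> op_le A B -> op_le (T A) (T B)) ->
  (forall A x a, posinv A -> 0 < a -> A x = a%:C *: x -> T A x = (g a)%:C *: x) ->
  forall a b u v eps, 0 < a -> 0 < b -> 0 < eps -> u ^+ 2 + v ^+ 2 = 1 ->
    u ^+ 2 * g a + v ^+ 2 * g b <= g (u ^+ 2 * a + v ^+ 2 * b + eps).
Proof.
move=> Tmono Teig a b u v eps a0 b0 eps0 uv.
(* [A] has eigenvectors (u, v) and (-v, u) for [a] and [b]. The second entry of [B] is chosen so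
   that [B - A] has determinant zero. *)
pose c := u ^+ 2 * a + v ^+ 2 * b; pose d := (a - b) * u * v.
pose e := v ^+ 2 * a + u ^+ 2 * b.
pose A := sym2 c d e; pose B := sym2 (c + eps) 0 (e + d ^+ 2 / eps).
have pA : posinv A.
  (* Strictly below both eigenvalues, so that [A] - m has positive determinant (a - m)(b - m); the
     last two terms of the expansion below vanish as u^2 + v^2 = 1. *)
  pose m := Num.min a b / 2.
  have mab0 : 0 < Num.min a b by rewrite lt_min a0 b0.
  have m0 : 0 < m by rewrite divr_gt0.
  have ma : m < a by rewrite (@lt_le_trans _ _ (Num.min a b)) ?ge_min ?lexx // /m; lra.
  have mb : m < b.
    by rewrite (@lt_le_trans _ _ (Num.min a b)) ?ge_min ?lexx ?orbT // /m; lra.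
  apply: (posinv_ge m0); rewrite /op_le -sym2_scalar sym2B; apply: sym2_ge0.
    have [u0|u0] := eqVneq u 0; rewrite /c.
      by move: uv; rewrite u0 expr0n /= add0r => ->; lra.
    have : 0 < u ^+ 2 by rewrite exprn_even_gt0.
    by have := sqr_ge0 v; move: uv; nra.
  have -> : (c - m) * (e - m) = (d - 0) ^+ 2
     + (a - m) * (b - m) * (u ^+ 2 + v ^+ 2) ^+ 2
     + m ^+ 2 * (1 - (u ^+ 2 + v ^+ 2) ^+ 2)
     - m * (a + b) * (u ^+ 2 + v ^+ 2) * (1 - (u ^+ 2 + v ^+ 2)).
    by rewrite /c /e /d; ring.
  have : 0 < (a - m) * (b - m) by rewrite mulr_gt0 // subr_gt0.
  by rewrite uv; nra.
have AB : op_le A B.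
  rewrite /op_le sym2B; apply: sym2_ge0; first lra.
  have -> : (c + eps - c) * (e + d ^+ 2 / eps - e) = d ^+ 2 by field; rewrite gt_eqF.
  by rewrite sub0r sqrrN.
have pB := posinv_le pA AB.
pose v1 : C2 := (u%:C, v%:C); pose v2 : C2 := ((- v)%:C, u%:C).
pose e1 : C2 := (1%:C, 0%:C).
have Av1 : A v1 = a%:C *: v1.
  apply: (@pair_equal_spec _ _ _ _ _ _).2.
  split; rewrite /= /GRing.scale /= -!rmorphM -!rmorphD; congr (_%:C).
    by rewrite /c /d -[RHS]mulr1 -uv; ring.
  by rewrite /e /d -[RHS]mulr1 -uv; ring.
have Av2 : A v2 = b%:C *: v2.
  apply: (@pair_equal_spec _ _ _ _ _ _).2.
  split; rewrite /= /GRing.scale /= -!rmorphM -!rmorphD; congr (_%:C).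
    by rewrite /c /d -[RHS]mulr1 -uv; ring.
  by rewrite /e /d -[RHS]mulr1 -uv; ring.
have Be1 : B e1 = (c + eps)%:C *: e1.
  apply: (@pair_equal_spec _ _ _ _ _ _).2.
  split; rewrite /= /GRing.scale /= -!rmorphM -!rmorphD; congr (_%:C); ring.
have e1E : e1 = u%:C *: v1 + (- v)%:C *: v2.
  apply: (@pair_equal_spec _ _ _ _ _ _).2.
  split; rewrite /= /GRing.scale /= -!rmorphM -!rmorphD; congr (_%:C).
    by rewrite -uv; ring.
  by ring.
have c0 : 0 < c + eps.
  by rewrite ltr_wpDl // addr_ge0 // mulr_ge0 ?sqr_ge0 // ltW.
(* At e1 = u v1 - v v2 the form of [T A] is u^2 g(a) + v^2 g(b), while e1 is an eigenvector of
   [B]. *)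
have := op_le_qf (Tmono _ _ pA pB AB) e1; rewrite /qf (Teig B e1 _ pB c0 Be1).
rewrite {1}e1E bopD !bopZ (Teig A v1 a pA a0 Av1) (Teig A v2 b pA b0 Av2).
rewrite ripDl !ripZl !rip_real.
by rewrite /c; lra.
Qed.

End Symmetric2x2.

(** * Operator monotone functions *)

Section ConcaveFunctions.
Variable R : realType.
Implicit Types (a b l s t u : R) (g : R -> R).

Definition concave_pos g := forall a b l, 0 < a -> 0 < b -> 0 <= l <= 1 ->
  l * g a + (1 - l) * g b <= g (l * a + (1 - l) * b).

(** Chords of a concave function decrease in slope: 1 is the mean of t and u with weight (1 - u)/(t
    - u) on t. *)
Lemma concave_pos_slopes g u t : concave_pos g -> g 1 = 1 -> 0 < u -> u < 1 -> 1 < t ->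
  (1 - u) * (g t - 1) <= (t - 1) * (1 - g u).
Proof.
move=> cg g1 u0 u1 t1; have tu : 0 < t - u by lra.
have t0 : 0 < t by lra.
have := cg t u ((1 - u) / (t - u)) t0 u0.
have -> : (1 - u) / (t - u) * t + (1 - (1 - u) / (t - u)) * u = 1.
  by field; rewrite gt_eqF.
have -> : (1 - u) / (t - u) * g t + (1 - (1 - u) / (t - u)) * g u =
  ((1 - u) * g t + (t - 1) * g u) / (t - u) by field; rewrite gt_eqF.
rewrite g1 !ler_pdivrMr // mul1r divr_ge0 ?(ltW tu) ?subr_ge0 ?(ltW u1) //=.
by move=> h; have := h ltac:(lra); lra.
Qed.

Lemma concave_pos_flat g t : concave_pos g ->
  (forall u, 0 < u -> u <= 1 -> g u = 1) -> 1 < t -> g t <= 1.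
Proof.
move=> cg gu t1; have h0 : 0 < 1 / 2 :> R by lra.
have h1 : 1 / 2 < 1 :> R by lra.
have := @concave_pos_slopes g (1 / 2) t cg (gu _ ltr01 (lexx _)) h0 h1 t1.
by rewrite (gu _ h0 (ltW h1)); nra.
Qed.

(** The slope is the supremum of the chord slopes to the right of 1. Left chord slopes bound it from
    above, and the point where g exceeds 1 makes it positive. *)
Lemma concave_pos_tangent g : concave_pos g -> g 1 = 1 ->
  (exists2 t, 1 < t & 1 < g t) ->
  exists2 s, 0 < s & forall t, 0 < t -> g t <= 1 + s * (t - 1).
Proof.
move=> cg g1 [t0 t01 gt0].
pose S := [set (g t - 1) / (t - 1) | t in [set t : R | 1 < t]].
have S0 : S !=set0 by exists ((g t0 - 1) / (t0 - 1)); exists t0.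
have ubS u : 0 < u -> u < 1 -> ubound S ((1 - g u) / (1 - u)).
  move=> u0 u1 _ [t /= t1 <-].
  rewrite ler_pdivrMr ?subr_gt0 // mulrAC ler_pdivlMr ?subr_gt0 //.
  by rewrite mulrC [leRHS]mulrC; exact: concave_pos_slopes.
have h0 : 0 < 1 / 2 :> R by lra.
have h1 : 1 / 2 < 1 :> R by lra.
have hS : has_sup S by split => //; eexists; exact: ubS h0 h1.
have sup_ge t : 1 < t -> (g t - 1) / (t - 1) <= sup S.
  by move=> t1; apply: ub_le_sup; [case: hS|exists t].
exists (sup S).
  by apply: lt_le_trans (sup_ge _ t01); rewrite divr_gt0 // subr_gt0.
move=> t tpos; have [t1|t1|->] := ltgtP t 1.
- have := ge_sup S0 (ubS _ tpos t1); rewrite ler_pdivlMr ?subr_gt0 //; lra.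
- by have := sup_ge _ t1; rewrite ler_pdivrMr ?subr_gt0 //; lra.
- by rewrite g1 subrr mulr0 addr0.
Qed.

End ConcaveFunctions.

Section MonotoneCalculus.
Variable R : realType.
Local Notation C2 := (C2 R).
Variables (T : bop C2 -> bop C2) (g : R -> R).
Hypothesis Tmono :
  forall A B, posinv A -> posinv B -> op_le A B -> op_le (T A) (T B).
Hypothesis Teig : forall A (x : C2) (a : R),
  posinv A -> 0 < a -> A x = a%:C *: x -> T A x = (g a)%:C *: x.
Hypothesis gcont : forall t, 0 < t -> {for t, continuous g}.

(** [T] is kept abstract, known only on eigenvectors, to cover both A |-> f(A) and A |-> f(A^-1)^-1.
    Scalar operators already give monotonicity of g. *)
Lemma monotone_calculus_homo a b : 0 < a -> a <= b -> g a <= g b.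
Proof.
move=> a0 ab; have b0 := lt_le_trans a0 ab.
have pa : posinv (scalar_op C2 a) := posinv_ge a0 (op_le_refl _).
have pb : posinv (scalar_op C2 b) := posinv_ge b0 (op_le_refl _).
have lab : op_le (scalar_op C2 a) (scalar_op C2 b).
  by rewrite /op_le /scalar_op -scalerBl -rmorphB; apply: positive_scalar; rewrite subr_ge0.
pose e1 : C2 := (1%:C, 0%:C).
have := op_le_qf (Tmono pa pb lab) e1; rewrite /qf.
rewrite (@Teig _ e1 a) // (@Teig _ e1 b) // !ripZl rip_real.
by rewrite mul1r mul0r addr0 !mulr1.
Qed.

(** Take u^2 = l and v^2 = 1 - l in the 2x2 inequality, and let eps tend to 0 by continuity of g. *)
Lemma monotone_calculus_concave_pos : concave_pos g.
Proof.
move=> a b l a0 b0 /andP[l0 l1]; set c := l * a + _.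
have c0 : 0 < c.
  have [l00|lN0] := eqVneq l 0; first by rewrite /c l00 mul0r add0r subr0 mul1r.
  have l_gt0 : 0 < l by rewrite lt_def lN0.
  by rewrite /c; have := mulr_gt0 l_gt0 a0; nra.
have uv : Num.sqrt l ^+ 2 + Num.sqrt (1 - l) ^+ 2 = 1.
  by rewrite !sqr_sqrtr ?subr_ge0 // addrC subrK.
have H := monotone_calculus_concave Tmono Teig a0 b0 _ uv.
apply/ler_addgt0Pr => e e0.
have /cvgrPdist_lt /(_ e e0) /nbhs_ballP[d /= d0 dP] := gcont c0.
have d2 : 0 < d / 2 by rewrite divr_gt0.
have := H _ d2; rewrite !sqr_sqrtr ?subr_ge0 // -/c => /le_trans; apply.
have : ball c d (c + d / 2).
  by rewrite /ball /= opprD addrA subrr sub0r normrN gtr0_norm //; lra.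
by move=> /dP /=; rewrite distrC => /ltW /ler_normlW; lra.
Qed.

End MonotoneCalculus.

Section Eigenvectors.
Variables (R : realType) (E : hilbertType R).
Implicit Types (A B : bop E) (x : E) (a b l : R) (f : R -> R).

Lemma eigenvalue_between a b A x l : op_between a b A -> x != 0 ->
  A x = l%:C *: x -> a <= l <= b.
Proof.
move=> Aab x0 Ax; have n0 : 0 < nr x ^+ 2.
  rewrite exprn_gt0 // lt_def nr_ge0 andbT.
  by apply: contra x0 => /eqP/nr_eq0 ->.
by have := op_between_qf x Aab; rewrite /qf Ax ripZl ripxx !ler_pM2r.
Qed.

Definition cont_pos f := forall t : R, 0 < t -> {for t, continuous f}.

Lemma cont_pos_seg f a b : cont_pos f -> 0 < a -> cont_seg a b f.
Proof. by move=> cf a0 t /andP[at_ _]; apply/cf/(lt_le_trans a0). Qed.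

Lemma fun_calc_eigen_pos f A x l : cont_pos f -> posinv A -> A x = l%:C *: x ->
  fun_calc f A x = (f l)%:C *: x.
Proof.
move=> cf /posinv_between[a [b [a0 ab Aab]]] Ax.
have [->|x0] := eqVneq x 0; first by rewrite bop_fun0 scaler0.
apply: (fun_calc_eigen ab Aab) => //; first exact: cont_pos_seg.
exact: eigenvalue_between Aab x0 Ax.
Qed.

Lemma op_inv_eigen A x l : posinv A -> l != 0 -> A x = l%:C *: x ->
  op_inv A x = (l^-1)%:C *: x.
Proof.
move=> pA l0 Ax.
have : op_inv A (A x) = x by rewrite -bop_mulE mull_op_inv.
rewrite Ax bopZ => {2}<-; rewrite scalerA -rmorphM mulVf //.
by rewrite scale1r.
Qed.

Lemma fun_calc_posinv f A : cont_pos f ->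
  (forall s t : R, 0 < s -> s <= t -> f s <= f t) -> (forall t, 0 < t -> 0 < f t) ->
  posinv A -> posinv (fun_calc f A).
Proof.
move=> cf fh f0 /posinv_between[a [b [a0 ab Aab]]].
apply: (posinv_ge (f0 a a0)); rewrite -(@fun_calc_scalar _ _ _ _ _ Aab).
apply: (fun_calc_le ab Aab); [exact: cont_seg_cst|exact: cont_pos_seg|].
by move=> t /andP[at_ _]; exact: fh.
Qed.

End Eigenvectors.

Section RepresentingFunction.
Variables (R : realType) (f : R -> R).
Hypotheses (fmono : operator_monotone f) (f_ge0 : forall t, 0 < t -> 0 <= f t).
Hypothesis f1 : f 1 = 1.
Local Notation C2 := (C2 R).

Let fcont : cont_pos f := proj1 fmono.

Let Teig (A : bop C2) (x : C2) (a : R) : posinv A -> 0 < a -> A x = a%:C *: x ->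
  fun_calc f A x = (f a)%:C *: x.
Proof. by move=> pA _; exact: fun_calc_eigen_pos. Qed.

Lemma operator_monotone_homo a b : 0 < a -> a <= b -> f a <= f b.
Proof. exact: monotone_calculus_homo (proj2 fmono C2) Teig a b. Qed.

Lemma operator_monotone_concave : concave_pos f.
Proof. exact: monotone_calculus_concave_pos (proj2 fmono C2) Teig fcont. Qed.

(** For t < 1, t is a mean of 1 and t/2 with positive weight on 1, so concavity bounds f(t) below by
    that weight. *)
Lemma operator_monotone_gt0 t : 0 < t -> 0 < f t.
Proof.
move=> t0; have [t1|t1] := leP 1 t.
  by rewrite (lt_le_trans ltr01) // -f1 operator_monotone_homo.
have h : 0 < 1 - t / 2 by lra.
have l0 : 0 < t / 2 / (1 - t / 2) by rewrite divr_gt0 // divr_gt0.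
have l1 : t / 2 / (1 - t / 2) <= 1 by rewrite ler_pdivrMr //; lra.
have t20 : 0 < t / 2 by rewrite divr_gt0.
have := @operator_monotone_concave 1 (t / 2) (t / 2 / (1 - t / 2)) ltr01 t20.
rewrite (ltW l0) l1 => /(_ isT).
have -> : t / 2 / (1 - t / 2) * 1 + (1 - t / 2 / (1 - t / 2)) * (t / 2) = t.
  by field; rewrite gt_eqF //; lra.
apply: lt_le_trans; rewrite f1 mulr1 ltr_pwDl // mulr_ge0 ?subr_ge0 //.
exact: f_ge0.
Qed.

Let fs t := (f t^-1)^-1.

Let fs_cont : cont_pos fs.
Proof.
move=> t t0; apply: cvgV; first by rewrite gt_eqF // operator_monotone_gt0 // invr_gt0.
apply: (@continuous_comp _ _ _ (@GRing.inv R) f); first by apply: inv_continuous; rewrite gt_eqF.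
by apply: fcont; rewrite invr_gt0.
Qed.

Let Ts (A : bop C2) := op_inv (fun_calc f (op_inv A)).

Let fc_posinv (A : bop C2) : posinv A -> posinv (fun_calc f A).
Proof.
apply: fun_calc_posinv => //; [exact: operator_monotone_homo|exact: operator_monotone_gt0].
Qed.

(** Inversion reverses the order twice. [Ts] is the operator version of [fs], the adjoint of f. *)
Let Ts_mono A B : posinv A -> posinv B -> op_le A B -> op_le (Ts A) (Ts B).
Proof.
move=> pA pB AB; apply: op_inv_le; first exact/fc_posinv/posinv_inv.
by apply: (proj2 fmono); [exact: posinv_inv|exact: posinv_inv|exact: op_inv_le].
Qed.

Let Ts_eig (A : bop C2) (x : C2) (a : R) : posinv A -> 0 < a -> A x = a%:C *: x ->
  Ts A x = (fs a)%:C *: x.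
Proof.
move=> pA a0 Ax; apply: op_inv_eigen; first exact/fc_posinv/posinv_inv.
  by rewrite gt_eqF // operator_monotone_gt0 // invr_gt0.
apply: fun_calc_eigen_pos => //; first exact: posinv_inv.
by apply: op_inv_eigen => //; rewrite gt_eqF.
Qed.

Lemma operator_monotone_adjoint_concave : concave_pos (fun t => (f t^-1)^-1).
Proof. exact: monotone_calculus_concave_pos Ts_mono Ts_eig fs_cont. Qed.

(** Slope zero has to be excluded for f and for its adjoint [fs]; the second tangent is that of [fs]
    taken at t^-1. *)
Lemma operator_monotone_tangents : (exists2 t, 0 < t & f t != 1) ->
  (exists2 s, 0 < s & forall t, 0 < t -> f t <= 1 + s * (t - 1)) /\
  (exists2 s, 0 < s & forall t, 0 < t -> (f t)^-1 <= 1 + s * (t^-1 - 1)).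
Proof.
move=> [t t0 ft].
have fs1 : fs 1 = 1 by rewrite /fs invr1 f1 invr1.
have fsE u : 0 < u -> fs u = 1 -> f u^-1 = 1.
  by rewrite /fs => u0 h; rewrite -[f _]invrK h invr1.
(* Otherwise f = 1 on [1, oo), so [fs] = 1 on (0, 1]. The concave [fs] is then at most 1 beyond,
   that is f >= 1 on (0, 1), and f is constant. *)
have up : exists2 u, 1 < u & 1 < f u.
  apply: contrapT => h; have {}h u : 1 < u -> f u <= 1.
    by move=> u1; rewrite leNgt; apply/negP => fu; apply: h; exists u.
  have fu1 u : 1 <= u -> f u = 1.
    rewrite le_eqVlt => /predU1P[<-//|u1].
    by apply/eqP; rewrite eq_le h //= -f1 operator_monotone_homo // ltW.
  have [t1|t1] := leP 1 t; first by rewrite fu1 ?eqxx in ft.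
  have ti : 1 < t^-1 by rewrite invf_gt1.
  have : fs t^-1 <= 1.
    apply: concave_pos_flat operator_monotone_adjoint_concave _ ti => u u0 u1.
    by rewrite /fs fu1 ?invr1 // invf_ge1.
  rewrite /fs invrK leNgt => /negP; apply; rewrite invf_gt1 ?operator_monotone_gt0 //.
  by rewrite lt_neqAle ft -f1 operator_monotone_homo // ltW.
(* Otherwise f = 1 on (0, 1], and concavity gives f <= 1 beyond, contradicting [up]. *)
have down : exists2 u, 1 < u & 1 < fs u.
  apply: contrapT => h; have {}h u : 1 < u -> fs u <= 1.
    by move=> u1; rewrite leNgt; apply/negP => fu; apply: h; exists u.
  have fu1 u : 0 < u -> u <= 1 -> f u = 1.
    move=> u0; rewrite le_eqVlt => /predU1P[->//|u1].
    have ui : 1 < u^-1 by rewrite invf_gt1.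
    have := h _ ui; rewrite /fs invrK invf_le1 ?operator_monotone_gt0 // => fu.
    by apply/eqP; rewrite eq_le fu andbT -f1 operator_monotone_homo // ltW.
  have [u u1 fu] := up.
  by have := concave_pos_flat operator_monotone_concave fu1 u1; rewrite leNgt fu.
split.
  exact: concave_pos_tangent operator_monotone_concave f1 up.
have [s s0 sP] := concave_pos_tangent operator_monotone_adjoint_concave fs1 down.
exists s => // u u0; have := sP u^-1; rewrite invrK; apply; by rewrite invr_gt0.
Qed.

End RepresentingFunction.

(** * Operator means *)

Section RepresentedMean.
Variables (R : realType) (f : R -> R) (E : hilbertType R).
Variable s : bop E -> bop E -> bop E.
Hypotheses (fcont : cont_pos f) (fhomo : forall a b, 0 < a -> a <= b -> f a <= f b).
Hypotheses (f_gt0 : forall t, 0 < t -> 0 < f t) (fs : represents f s).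
Implicit Types A B X : bop E.

Lemma posinv_congr (S T A : bop E) : selfadj S -> S * T = 1 -> T * S = 1 ->
  posinv A -> posinv (S * A * S) /\ op_inv (S * A * S) = T * op_inv A * T.
Proof.
move=> sS ST TS pA.
have h1 : S * A * S * (T * op_inv A * T) = 1.
  by rewrite !mulrA -(mulrA (S * A) S T) ST mulr1 -(mulrA S A) mulr_op_inv // mulr1 ST.
have h2 : T * op_inv A * T * (S * A * S) = 1.
  by rewrite !mulrA -(mulrA (T * op_inv A) T S) TS mulr1 -(mulrA T _ A) mull_op_inv // mulr1 TS.
split; last exact: op_invE.
by split; [apply: positive_cong => //; case: pA|exists (T * op_inv A * T)].
Qed.

Lemma represented_posinv X A : posinv X -> posinv A -> posinv (s X A).
Proof.
move=> pX pA; have [[sS sT SS ST TS] TT] := posinv_sqrt pX.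
rewrite fs //; apply: (posinv_congr sS ST TS _).1.
apply: fun_calc_posinv => //; exact: (posinv_congr sT TS ST pA).1.
Qed.

Lemma represented_diag X : f 1 = 1 -> posinv X -> s X X = X.
Proof.
move=> f1 pX; have [[sS sT SS ST TS] TT] := posinv_sqrt pX.
set S := op_pow X _ in sS SS ST TS; set T := op_pow X _ in sT ST TS TT.
rewrite fs // -/S -/T -{1}SS !mulrA TS mul1r ST.
have b1 : op_between 1 1 (1 : bop E).
  by rewrite /op_between /scalar_op scale1r; split; exact: op_le_refl.
have -> : fun_calc f (1 : bop E) = 1.
  rewrite -[RHS](scale1r (1 : bop E)) -[RHS](@fun_calc_scalar _ _ _ _ _ b1 1).
  apply: (fun_calc_ext (lexx 1) b1); last exact: cont_seg_cst.
  by move=> t /le_anti <-.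
by rewrite mulr1 SS.
Qed.

Lemma fun_calc_affine (g : R -> R) (c : R) A : cont_pos g -> posinv A ->
  (forall t, 0 < t -> g t <= 1 + c * (t - 1)) ->
  op_le (fun_calc g A) (1 + c%:C *: (A - 1)).
Proof.
move=> cg /posinv_between[a [b [a0 ab Aab]]] gc.
have -> : 1 + c%:C *: (A - 1) = op_poly (1 + c *: ('X - 1)) A.
  by rewrite op_polyD op_polyZ op_polyB op_polyX !op_polyC /scalar_op !scale1r.
rewrite -(fun_calc_poly Aab); apply: (fun_calc_le ab Aab).
- exact: cont_pos_seg.
- by move=> t _; exact: continuous_horner.
- move=> t /andP[at_ _]; rewrite !hornerE; apply: gc; exact: lt_le_trans at_.
Qed.

(** Apply the tangent to B = X^-1/2 A X^-1/2 and conjugate by X^1/2, which sends 1 to X and B to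
    A. *)
Lemma represented_le c X A : posinv X -> posinv A ->
  (forall t, 0 < t -> f t <= 1 + c * (t - 1)) ->
  op_le (s X A) (X + c%:C *: (A - X)).
Proof.
move=> pX pA fc; have [[sS sT SS ST TS] TT] := posinv_sqrt pX.
set S := op_pow X _ in sS SS ST TS; set T := op_pow X _ in sT ST TS TT.
have pB := (posinv_congr sT TS ST pA).1.
rewrite fs //; apply: op_le_trans (op_le_cong sS (fun_calc_affine fcont pB fc)) _.
rewrite mulrDr mulrDl mulr1 SS bop_mulZr bop_mulZl mulrBr mulrBl mulr1 SS.
have -> : S * (T * A * T) * S = A by rewrite !mulrA ST mul1r -mulrA TS mulr1.
exact: op_le_refl.
Qed.

(** Here (X sigma A)^-1 = X^-1/2 f(B)^-1 X^-1/2, so the bound on 1/f is applied to B and conjugated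
    by X^-1/2. *)
Lemma represented_inv_le c X A : posinv X -> posinv A ->
  (forall t, 0 < t -> (f t)^-1 <= 1 + c * (t^-1 - 1)) ->
  op_le (op_inv (s X A)) (op_inv X + c%:C *: (op_inv A - op_inv X)).
Proof.
move=> pX pA fc; have [[sS sT SS ST TS] TT] := posinv_sqrt pX.
set S := op_pow X _ in sS SS ST TS; set T := op_pow X _ in sT ST TS TT.
have [pB iB] := posinv_congr sT TS ST pA.
have pF : posinv (fun_calc f (T * A * T)) by apply: fun_calc_posinv.
rewrite fs // (posinv_congr sS ST TS pF).2.
have [a [b [a0 ab Bab]]] := posinv_between pB.
have tN0 t : a <= t <= b -> 0 < t by move=> /andP[at_ _]; exact: lt_le_trans at_.
have ci : cont_seg a b (fun t => (f t)^-1).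
  by move=> t /tN0 t0; apply: cvgV; [rewrite gt_eqF // f_gt0|exact: fcont].
have cf : cont_seg a b f by exact: cont_pos_seg.
have one_calc : fun_calc (fun=> 1) (T * A * T) = 1.
  by rewrite (@fun_calc_scalar _ _ _ _ _ Bab) /scalar_op scale1r.
have iF : op_inv (fun_calc f (T * A * T)) = fun_calc (fun t => (f t)^-1) (T * A * T).
  apply: op_invE; rewrite -(fun_calcM ab Bab) // -one_calc;
    apply: (fun_calc_ext ab Bab); try exact: cont_seg_cst.
  - by move=> t /tN0 t0; rewrite mulfV // gt_eqF // f_gt0.
  - by move=> t /tN0 t0; rewrite mulVf // gt_eqF // f_gt0.
have iFle : op_le (op_inv (fun_calc f (T * A * T))) (1 + c%:C *: (op_inv (T * A * T) - 1)).
  have [_ <-] := op_between_inv a0 ab Bab.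
  have cinv : cont_seg a b (fun t => c * t^-1) by apply/cont_segZ/cont_seg_inv.
  have -> : 1 + c%:C *: (fun_calc (@GRing.inv R) (T * A * T) - 1) =
      fun_calc (fun t => (1 - c) + c * t^-1) (T * A * T).
    rewrite (fun_calcD ab Bab (@cont_seg_cst _ _ _ (1 - c)) cinv).
    rewrite (fun_calcZ ab Bab); last exact: cont_seg_inv.
    rewrite (fun_calc_scalar Bab) /scalar_op rmorphB scalerBl scale1r scalerBr.
    by rewrite -!addrA; congr (_ + _); rewrite addrC.
  rewrite iF; apply: (fun_calc_le ab Bab) => //.
    by move=> t tab; apply: cvgD; [exact: cvg_cst|exact: cinv].
  by move=> t /tN0 /fc /le_trans; apply; lra.
apply: op_le_trans (op_le_cong sT iFle) _.
rewrite iB mulrDr mulrDl mulr1 TT bop_mulZr bop_mulZl mulrBr mulrBl mulr1 TT.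
have -> : T * (S * op_inv A * S) * T = op_inv A by rewrite !mulrA TS mul1r -mulrA ST mulr1.
exact: op_le_refl.
Qed.

End RepresentedMean.

Section StrongLimits.
Variables (R : realType) (E : hilbertType R).
Implicit Types (A B X : bop E) (u : nat -> bop E) (x y : E) (a b e : R).

Lemma sot_cvg_rip u X x y e : sot_cvg u X -> 0 < e ->
  exists N, forall k, (N <= k)%N -> `|rip (X x) y - rip (u k x) y| <= e.
Proof.
move=> uX e0; have n0 : 0 < nr y + 1 by rewrite ltr_wpDl ?nr_ge0.
have e1 : 0 < e / (nr y + 1) by rewrite divr_gt0.
have /cvg_nrP/(_ _ e1)[N NP] := uX x; exists N => k /NP h.
rewrite -ripNl -ripDl (le_trans (norm_rip_CS _ _)) //.
apply: (@le_trans _ _ (e / (nr y + 1) * (nr y + 1))); last by rewrite divfK ?gt_eqF.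
by rewrite ler_pM ?nr_ge0 // lerDl.
Qed.

Lemma sot_cvg_between u X a b : (forall k, op_between a b (u k)) -> sot_cvg u X ->
  op_between a b X.
Proof.
move=> ub uX; have sX : selfadj X.
  apply: rip_selfadj => x y; apply/eqP; rewrite -subr_eq0 -normr_eq0.
  rewrite eq_le normr_ge0 andbT; apply/ler_addgt0Pr => e e0; rewrite add0r.
  have e2 : 0 < e / 2 by rewrite divr_gt0.
  have [N NP] := sot_cvg_rip x y uX e2; have [M MP] := sot_cvg_rip y x uX e2.
  have h1 := NP _ (leq_maxl N M); have h2 := MP _ (leq_maxr N M).
  rewrite (selfadj_rip (op_between_selfadj (ub _))) ripC in h1.
  set k := maxn N M in h1 h2.
  have -> : rip (X x) y - rip x (X y) =
    (rip y (X x) - rip (u k y) x) - (rip (X y) x - rip (u k y) x).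
    by rewrite (ripC y) (ripC x); ring.
  rewrite (le_trans (ler_normB _ _)) //.
  rewrite (ripC x (u k y)) in h1; lra.
split; apply: qf_op_le; try exact: selfadj_scalar; move=> // x; rewrite qf_scalar.
  apply/ler_addgt0Pr => e e0; have [N /(_ _ (leqnn N)) h] := sot_cvg_rip x x uX e0.
  have /andP[h1 _] := op_between_qf x (ub N).
  by move: h h1; rewrite /qf ler_norml => /andP[]; lra.
apply/ler_addgt0Pr => e e0; have [N /(_ _ (leqnn N)) h] := sot_cvg_rip x x uX e0.
have /andP[_ h1] := op_between_qf x (ub N).
by move: h h1; rewrite /qf ler_norml => /andP[]; lra.
Qed.

(** The decreasing numbers <u_k x, x> are bounded below, hence Cauchy, and |(u_i - u_j)x|^2 <= (b -
    a) <(u_i - u_j)x, x> carries this over to the vectors. *)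
Lemma decreasing_sot_cvg u a b : (forall k, op_between a b (u k)) ->
  (forall k, op_le (u k.+1) (u k)) -> exists X, sot_cvg u X.
Proof.
move=> ub udec.
have dec i j : (i <= j)%N -> op_le (u j) (u i).
  move=> /subnK <-; elim: (j - i)%N => [|k IH]; first exact: op_le_refl.
  by rewrite addSn; exact: op_le_trans (udec _) IH.
have [ab|ba] := leP a b; last first.
  by exists (u 0%N) => x; apply/cvg_nrP => e e0; exists 0%N => k _;
    rewrite (op_between_trivial ba (ub 0%N) (_ - _)) (_ : nr 0 = 0) ?ltW // /nr normr0.
apply: (@op_limit _ _ _ (`|a| + (b - a))).
  move=> k x.
  have P0 : positive (u k - scalar_op E a) by case: (ub k).
  have Pb : op_le (u k - scalar_op E a) (scalar_op E (b - a)).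
    apply: qf_op_le; [exact: positive_selfadj|exact: selfadj_scalar|move=> y].
    rewrite qfD qfN !qf_scalar.
    by have /andP[_ k1] := op_between_qf y (ub k); lra.
  have h := positive_nr_bound x P0 Pb.
  have h2 := op_le_qf Pb x; rewrite qf_scalar in h2.
  have ba0 : 0 <= b - a by rewrite subr_ge0.
  have h3 : nr ((u k - scalar_op E a) x) <= (b - a) * nr x.
    rewrite -ler_sqr ?nnegrE ?mulr_ge0 ?nr_ge0 // exprMn (le_trans h) //.
    by rewrite expr2 -mulrA ler_wpM2l.
  have -> : u k x = a%:C *: x + (u k - scalar_op E a) x by rewrite bop_addE addrC subrK.
  by rewrite (le_trans (nrD _ _)) // nrZ mulrDl lerD2l.
move=> x; apply: cauchy_nr_cvg => e e0.
pose S := [set qf (u k) x | k in [set: nat]].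
have hS : has_inf S.
  split; first by exists (qf (u 0%N) x); exists 0%N.
  exists (a * nr x ^+ 2) => _ [k _ <-].
  by have /andP[] := op_between_qf x (ub k).
(* The added 1 keeps the divisor positive when a = b. *)
have d0 : 0 < e ^+ 2 / (b - a + 1) by rewrite divr_gt0 ?exprn_gt0 // ltr_wpDl ?subr_ge0.
have [_ [N _ <-] NP] := inf_adherent d0 hS.
exists N.
have key i j : (N <= i)%N -> (i <= j)%N -> nr (u i x - u j x) <= e.
  move=> Ni ij; have P0 : positive (u i - u j) by exact: dec.
  have Pb : op_le (u i - u j) (scalar_op E (b - a)).
    apply: qf_op_le; [exact: positive_selfadj|exact: selfadj_scalar|move=> y].
    rewrite qfD qfN qf_scalar.
    have /andP[_ k1] := op_between_qf y (ub i); have /andP[k2 _] := op_between_qf y (ub j).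
    by lra.
  have := positive_nr_bound x P0 Pb; rewrite bop_addE bop_oppE qfD qfN => h.
  rewrite -ler_sqr ?nnegrE ?nr_ge0 ?(ltW e0) // (le_trans h) //.
  have k1 := op_le_qf (dec _ _ Ni) x.
  have k2 : inf S <= qf (u j) x by apply: ge_inf; [case: hS|exists j].
  have ba1 : 0 < b - a + 1 by rewrite ltr_wpDl ?subr_ge0.
  have k3 : qf (u i) x - qf (u j) x <= e ^+ 2 / (b - a + 1) by move: NP; lra.
  have k4 := op_le_qf (dec _ _ ij) x.
  rewrite -[leRHS](divfK (lt0r_neq0 ba1)) [leRHS]mulrC.
  by apply: ler_pM => //; rewrite ?subr_ge0 // lerDl.
move=> i j Ni Nj; have [ij|/ltnW ji] := leqP i j; first exact: key.
by rewrite -nrN opprB; exact: key.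
Qed.

End StrongLimits.

(** * Existence of the fixed point behind the deformed mean *)

Section DeformedMean.
Variables (R : realType) (E : hilbertType R) (n : nat).
Variables (F : ('I_n -> bop E) -> bop E) (s : bop E -> bop E -> bop E) (f : R -> R).
Hypotheses (meanF : nvar_mean F) (KAs : kubo_ando s) (fs : represents f s).
Hypotheses (fcont : cont_pos f) (f1 : f 1 = 1).
Variables (A : 'I_n -> bop E) (m M : R).
Hypotheses (m0 : 0 < m) (mM : m <= M) (Aab : forall j, op_between m M (A j)).

Lemma scalar_op_le (a b : R) : a <= b -> op_le (scalar_op E a) (scalar_op E b).
Proof.
move=> ab; rewrite /op_le /scalar_op -scalerBl -rmorphB.
by apply: positive_scalar; rewrite subr_ge0.
Qed.

Lemma posinv_scalar (c : R) : 0 < c -> posinv (scalar_op E c).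
Proof. by move=> c0; exact: posinv_ge c0 (op_le_refl _). Qed.

(** Congruence invariance with S = sqrt(c) I. *)
Lemma nvar_mean_scalar c : 0 < c -> F (fun=> scalar_op E c) = scalar_op E c.
Proof.
move=> c0; pose S := scalar_op E (Num.sqrt c).
have s0 : 0 < Num.sqrt c by rewrite sqrtr_gt0.
have sS : selfadj S by exact: selfadj_scalar.
have SS : S * S = scalar_op E c.
  rewrite /S /scalar_op bop_mulZl mul1r scalerA -rmorphM -expr2 sqr_sqrtr //.
  exact: ltW.
have p1 : posinv (1 : bop E) by have := posinv_scalar ltr01; rewrite /scalar_op scale1r.
case: meanF => _ _ /(_ (fun=> 1) S) + _ F1.
rewrite F1 adjointE // !mulr1 SS => <- //.
by have [] := posinv_scalar s0.
Qed.

Lemma kubo_ando_between a b X B : 0 < a -> a <= b ->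
  op_between a b X -> op_between a b B -> op_between a b (s X B).
Proof.
move=> a0 ab Xab Bab; have b0 := lt_le_trans a0 ab; case: KAs => _ mono _ _ _.
have pos (Y : bop E) : op_between a b Y -> positive Y.
  by move=> [h _]; apply: positive_le h; apply: positive_scalar; exact: ltW.
have pa := @positive_scalar R E _ (ltW a0); have pb := @positive_scalar R E _ (ltW b0).
split; [rewrite -(represented_diag fs f1 (posinv_scalar a0))
       |rewrite -(represented_diag fs f1 (posinv_scalar b0))].
  by apply: mono => //; try exact: pos; [case: Xab|case: Bab].
by apply: mono => //; try exact: pos; [case: Xab|case: Bab].
Qed.

Let T X := F (fun j => s X (A j)).

Let T_between X : op_between m M X -> op_between m M (T X).
Proof.
move=> Xab; have M0 := lt_le_trans m0 mM; case: meanF => _ mono _ _ _.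
have sab j : op_between m M (s X (A j)) by exact: kubo_ando_between.
have sp j : posinv (s X (A j)) by have [] := op_between_inv m0 mM (sab j).
split; rewrite -nvar_mean_scalar //; apply: mono => // j; try exact: posinv_scalar.
  by case: (sab j).
by case: (sab j).
Qed.

(** [T] preserves the interval [mI, MI]. Starting at MI, the first step therefore goes down,
    monotonicity keeps the iterates decreasing, and the limit stays invertible. Downward continuity
    of sigma and then of the mean identifies it as fixed. *)
Lemma deformed_fixpoint_exists : exists X, op_between m M X /\ X = T X.
Proof.
have M0 := lt_le_trans m0 mM.
pose u k := iter k T (scalar_op E M).
have ub k : op_between m M (u k).
  elim: k => [|k IH]; last exact: T_between.
  by split; [exact: scalar_op_le|exact: op_le_refl].
have pos (Y : bop E) : op_between m M Y -> positive Y.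
  by move=> [h _]; apply: positive_le h; apply: positive_scalar; exact: ltW.
case: KAs => spos smono _ scont _; case: (meanF) => Fpos Fmono _ Fcont _.
have sp Y j : op_between m M Y -> posinv (s Y (A j)).
  by move=> Yab; have [] := op_between_inv m0 mM (kubo_ando_between m0 mM Yab (Aab j)).
have udec k : op_le (u k.+1) (u k).
  elim: k => [|k IH]; first by case: (ub 1%N).
  apply: Fmono => j; [exact: sp (ub k.+1)|exact: sp (ub k)|].
  apply: smono => //; [exact: pos (ub k.+1)|exact: pos|exact: pos (ub k)|exact: pos|].
  exact: op_le_refl.
have [X uX] := decreasing_sot_cvg ub udec; exists X.
have Xab := sot_cvg_between ub uX; split=> //.
have uTX : sot_cvg (fun k => u k.+1) (T X).
  apply: (Fcont (fun j k => s (u k) (A j)) (fun j => s X (A j))) => [j k|j|].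
  - exact: sp (ub k).
  - exact: sp Xab.
  right=> j; apply: (scont u (fun=> A j)) => //; try by move=> *; apply: pos.
  by split=> [k|x]; [exact: op_le_refl|exact: cvg_cst].
apply: sot_cvg_unique uTX => x; have := uX x.
by rewrite -(cvg_shiftS (fun k => u k x)).
Qed.

(** Existence excludes the default value 0 of [xget], so the selected operator solves the
    equation. *)
Lemma deformedP : let X := deformed F s A in posinv X /\ X = T X.
Proof.
rewrite /deformed; case: xgetP => [X _ //|].
have [X [Xab XT]] := deformed_fixpoint_exists.
by move=> /(_ X) []; split=> //; have [] := op_between_inv m0 mM Xab.
Qed.

End DeformedMean.

(** * Real powers and the two constants *)

Section ScalarInequalities.
Variable R : realType.
Implicit Types (a m M p r t u y h : R).

Lemma powR_expR u p : 0 < u -> u `^ p = expR (p * ln u).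
Proof. by move=> u0; rewrite /powR gt_eqF. Qed.

Lemma powRD_gt0 u p r : 0 < u -> u `^ (p + r) = u `^ p * u `^ r.
Proof. by move=> u0; rewrite !powR_expR // mulrDl expRD. Qed.

Lemma ln_le_sub1 u : 0 < u -> ln u <= u - 1.
Proof. by move=> u0; rewrite -{1}[u](subrK 1) addrC le_ln1Dx //; lra. Qed.

(** For p <= 0, e^(p ln u) >= 1 + p ln u and ln u <= u - 1. For p >= 1, write u^p = u u^(p-1) and
    use u ln u >= u - 1. *)
Lemma powR_bernoulli u p : 0 < u -> p <= 0 \/ 1 <= p -> 1 + p * (u - 1) <= u `^ p.
Proof.
move=> u0; have lu := ln_le_sub1 u0; case=> p0.
  rewrite powR_expR //; apply: le_trans (expR_ge1Dx _); nra.
have -> : u `^ p = u * u `^ (p - 1).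
  by rewrite mulr_powRB1 ?(ltW u0) // (lt_le_trans ltr01).
rewrite (powR_expR _ u0); apply: (@le_trans _ _ (u * (1 + (p - 1) * ln u))); last first.
  by rewrite ler_pM2l // expR_ge1Dx.
have ui0 : 0 < u^-1 by rewrite invr_gt0.
have := ln_le_sub1 ui0; rewrite lnV ?posrE // => l2.
have : u * (- ln u) <= u * (u^-1 - 1) by rewrite ler_pM2l.
by rewrite mulrBr mulfV ?gt_eqF //; nra.
Qed.

Lemma powR_tangent t u p : 0 < t -> 0 < u -> p <= 0 \/ 1 <= p ->
  t `^ p + p * t `^ (p - 1) * (u - t) <= u `^ p.
Proof.
move=> t0 u0 hp; have ut0 : 0 < u / t by rewrite divr_gt0.
have := powR_bernoulli ut0 hp => h.
have tp0 : 0 < t `^ p by exact: powR_gt0.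
have -> : u `^ p = t `^ p * (u / t) `^ p.
  by rewrite -powRM ?(ltW t0) ?(ltW ut0) // mulrC divfK // gt_eqF.
apply: le_trans (ler_wpM2l (ltW tp0) h).
have -> : t `^ (p - 1) = t `^ p / t.
  by rewrite powRD_gt0 // powR_inv1 // ltW.
rewrite le_eqVlt; apply/orP; left; apply/eqP; field; by rewrite gt_eqF.
Qed.

(** The tangent at t, evaluated at m and at M, is averaged with weights M - t and t - m; its linear
    terms cancel. *)
Lemma powR_chord m M t p : 0 < m -> m < M -> m <= t <= M -> p <= 0 \/ 1 <= p ->
  t `^ p <= (M `^ p - m `^ p) / (M - m) * t + (M * m `^ p - m * M `^ p) / (M - m).
Proof.
move=> m0 mM /andP[mt tM] hp; have t0 := lt_le_trans m0 mt.
have M0 := lt_trans m0 mM; have d0 : 0 < M - m by rewrite subr_gt0.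
have h1 := powR_tangent t0 m0 hp; have h2 := powR_tangent t0 M0 hp.
have -> : (M `^ p - m `^ p) / (M - m) * t + (M * m `^ p - m * M `^ p) / (M - m) =
  ((M - t) * m `^ p + (t - m) * M `^ p) / (M - m) by field; rewrite gt_eqF.
rewrite ler_pdivlMr //.
have k1 : 0 <= M - t by rewrite subr_ge0.
have k2 : 0 <= t - m by rewrite subr_ge0.
have := ler_wpM2l k1 h1; have := ler_wpM2l k2 h2; nra.
Qed.

Lemma powR_le0_anti p u t : p <= 0 -> 0 < u -> u <= t -> t `^ p <= u `^ p.
Proof.
move=> p0 u0 ut; have t0 := lt_le_trans u0 ut.
rewrite -[p]opprK ![_ `^ (- - p)]powRN lef_pV2 ?posrE ?powR_gt0 //.
by apply: ge0_ler_powR; rewrite ?nnegrE ?oppr_ge0 // ltW.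
Qed.

(** [gamma] is the maximum over [m, M] of the concave function chord(y) - a y^p, whose critical
    point is [t0]; outside the interval the nearer endpoint takes over. *)
Lemma gamma_bound m M p a y : 0 < m -> m < M -> p < 0 -> 0 < a -> m <= y <= M ->
  (M `^ p - m `^ p) / (M - m) * y + (M * m `^ p - m * M `^ p) / (M - m)
  <= a * y `^ p + gamma m M p a.
Proof.
move=> m0 mM p0 a0 /andP[my yM].
have M0 := lt_trans m0 mM; have y0 := lt_le_trans m0 my.
have d0 : 0 < M - m by rewrite subr_gt0.
set s := (M `^ p - m `^ p) / (M - m); set b := _ / (M - m).
pose q := (M `^ p - m `^ p) / (a * p * (M - m)).
have dN0 : M - m != 0 by rewrite gt_eqF.
have pN0 : p != 0 by rewrite lt_eqF.
have aN0 : a != 0 by rewrite gt_eqF.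
have sE : s = a * p * q by rewrite /s /q; field; rewrite dN0 pN0 aN0.
have chordm : s * m + b = m `^ p by rewrite /s /b; field; rewrite gt_eqF.
have chordM : s * M + b = M `^ p by rewrite /s /b; field; rewrite gt_eqF.
have hp : p <= 0 \/ 1 <= p by left; exact: ltW.
have p1 : p - 1 < 0 by lra.
have q0 : 0 < q.
  rewrite /q -mulrNN -invrN divr_gt0 ?oppr_gt0 //.
    rewrite subr_lt0 -[p]opprK ![_ `^ (- - p)]powRN ltf_pV2 ?posrE ?powR_gt0 //.
    by rewrite gt0_ltr_powR ?nnegrE ?oppr_gt0 // ltW.
  by rewrite nmulr_rlt0 // nmulr_llt0.
have t0E : gamma_t0 m M p a = q `^ (1 / (p - 1)) by [].
set t0 := gamma_t0 m M p a in t0E.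
have t0_gt0 : 0 < t0 by rewrite t0E powR_gt0.
have t0p1 : t0 `^ (p - 1) = q.
  by rewrite t0E -powRrM divfK ?lt_eqF // powRr1 // ltW.
have t0p : t0 `^ p = q `^ (p / (p - 1)).
  by rewrite t0E -powRrM; congr (_ `^ _); rewrite mulrC mulrA mulr1.
have t0t0 : t0 `^ p = t0 * q.
  by rewrite -t0p1 mulrC -{3}[t0]powRr1 ?(ltW t0_gt0) // -powRD_gt0 // subrK.
have ap : a * p < 0 by rewrite pmulr_rlt0.
rewrite /gamma -/t0 -/q; case: ifP => [_|tmM].
  (* At [t0] the tangent of a y^p has slope a p q = s, that of the chord, so the difference does not
     depend on y. *)
  have := powR_tangent t0_gt0 y0 hp; rewrite t0p1 => h.
  have := ler_wpM2l (ltW a0) h; rewrite -t0p -/b sE t0t0; nra.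
case: ifP => [Mt0|t0M].
  have := ler_wpM2l (ltW a0) (powR_tangent M0 y0 hp).
  have k : q <= M `^ (p - 1) by rewrite -t0p1 powR_le0_anti // ltW.
  have : a * p * M `^ (p - 1) <= s by rewrite sE ler_nM2l.
  move: chordM yM; nra.
have t0m : t0 <= m.
  by move: tmM t0M; case: (ltP t0 m) => [/ltW//|mt0] /=; case: (leP t0 M) => //= /ltW ->.
have := ler_wpM2l (ltW a0) (powR_tangent m0 y0 hp).
have k : m `^ (p - 1) <= q by rewrite -t0p1 powR_le0_anti // ltW.
have : s <= a * p * m `^ (p - 1) by rewrite sE ler_nM2l.
move: chordm my; nra.
Qed.

(** The constant has the form c v^r, and Bernoulli's lower bound c (1 + r (v - 1)) is exactly 1. *)
Lemma kantorovich_ge1 h r : 1 < h -> 1 <= r -> 1 <= kantorovich h r.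
Proof.
move=> h1 r1; rewrite /kantorovich; case: ifP => // /negbT.
rewrite !negb_or => /and3P[hN1 rN0 rN1].
have r_gt1 : 1 < r by rewrite lt_neqAle eq_sym rN1.
have h0 : 0 < h := lt_trans ltr01 h1.
have hr : h < h `^ r.
  have lh : 0 < ln h by rewrite ln_gt0.
  rewrite powR_expR // -{1}[h]lnK ?posrE // ltr_expR; nra.
set k := h `^ r in hr *.
have k1 : 0 < h - 1 by lra.
have k2 : 0 < k - h by lra.
have k3 : 0 < k - 1 by lra.
have k4 : 0 < r - 1 by lra.
have rpos : 0 < r by lra.
set v := (r - 1) / r * ((k - 1) / (k - h)).
have v0 : 0 < v by rewrite mulr_gt0 ?divr_gt0.
have c0 : 0 < (k - h) / ((r - 1) * (h - 1)) by rewrite divr_gt0 ?mulr_gt0.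
have := ler_wpM2l (ltW c0) (powR_bernoulli v0 (or_intror r1)).
apply: le_trans; rewrite le_eqVlt; apply/orP; left; apply/eqP.
rewrite /v; field; by rewrite !gt_eqF.
Qed.

End ScalarInequalities.

(** * The theorem *)

Section DeformedBounds.
Variables (R : realType) (E : hilbertType R) (n : nat).
Variables (F : ('I_n -> bop E) -> bop E) (s : bop E -> bop E -> bop E) (f : R -> R).
Hypotheses (KAs : kubo_ando s) (fs : represents f s).
Hypotheses (fcont : cont_pos f) (f1 : f 1 = 1).
Hypotheses (fhomo : forall a b, 0 < a -> a <= b -> f a <= f b).
Hypotheses (f_gt0 : forall t, 0 < t -> 0 < f t).
Variables (w : 'I_n -> R) (A : 'I_n -> bop E).
Hypotheses (w_ge0 : forall j, 0 <= w j) (w_sum : \sum_j w j = 1).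
Hypothesis (bnd : between_harm_arith w F).
Hypothesis Apos : forall j, posinv (A j).
Variable X : bop E.
Hypotheses (pX : posinv X) (XF : X = F (fun j => s X (A j))).

Lemma wsum_const (C : bop E) : \sum_j (w j)%:C *: C = C.
Proof. by rewrite -scaler_suml -rmorph_sum w_sum scale1r. Qed.

Lemma wsum_affine (c : R) (B : 'I_n -> bop E) (C : bop E) :
  \sum_j (w j)%:C *: (C + c%:C *: (B j - C)) = C + c%:C *: (\sum_j (w j)%:C *: B j - C).
Proof.
under eq_bigr do rewrite scalerDr scalerA mulrC -scalerA scalerBr.
rewrite big_split /= wsum_const -scaler_sumr; congr (_ + _ *: _).
by rewrite sumrB wsum_const.
Qed.

Lemma op_le_affine_cancel (c : R) (B C : bop E) :
  0 < c -> op_le C (C + c%:C *: (B - C)) -> op_le C B.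
Proof.
move=> c0; rewrite /op_le addrAC subrr add0r => h.
have ci0 : 0 <= c^-1 by rewrite invr_ge0 ltW.
by have := positiveZ ci0 h; rewrite scalerA -rmorphM mulVf ?gt_eqF // scale1r.
Qed.

Lemma wsum_le (B C : 'I_n -> bop E) : (forall j, op_le (B j) (C j)) ->
  op_le (\sum_j (w j)%:C *: B j) (\sum_j (w j)%:C *: C j).
Proof. by move=> BC; apply: op_le_sum => j; exact: op_leZ. Qed.

Let sp j : posinv (s X (A j)). Proof. exact: (represented_posinv fcont fhomo f_gt0 fs). Qed.

(** X <= sum_j w_j (X sigma A_j) <= X + c (sum_j w_j A_j - X), from which X cancels. *)
Lemma deformed_le_arith c : 0 < c -> (forall t, 0 < t -> f t <= 1 + c * (t - 1)) ->
  op_le X (\sum_j (w j)%:C *: A j).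
Proof.
move=> c0 fc; apply: (op_le_affine_cancel c0); rewrite -wsum_affine {1}XF.
apply: op_le_trans (bnd sp).2 _; apply: wsum_le => j.
exact: (represented_le fcont fs).
Qed.

Lemma posinv_wsum (B : 'I_n -> bop E) : (forall j, posinv (B j)) ->
  posinv (\sum_j (w j)%:C *: B j).
Proof.
move=> pB; have [j wj] : exists j, 0 < w j.
  apply: contrapT => h; have : \sum_j w j = 0.
    apply: big1 => j _; apply/eqP; rewrite eq_le w_ge0 andbT leNgt; apply/negP => wj.
    by apply: h; exists j.
  by rewrite w_sum => /eqP; rewrite oner_eq0.
have [a [b [a0 ab [aB _]]]] := posinv_between (pB j).
apply: (@posinv_ge _ _ (w j * a)); first by rewrite mulr_gt0.
rewrite (bigD1 j) //= -[X in op_le X _]addr0; apply: op_leD.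
  by have := op_leZ (ltW wj) aB; rewrite /scalar_op scalerA -rmorphM.
apply: (big_ind (fun C : bop E => op_le 0 C)); first exact: op_le_refl.
  by move=> C D hC hD; have := op_leD hC hD; rewrite addr0.
by move=> i _; apply: (positive_le0 _).1; apply: positiveZ => //; case: (pB i).
Qed.

(** Inverting H_w <= M at the tuple X sigma A_j gives X^-1 <= sum_j w_j (X sigma A_j)^-1; then the
    same cancellation with X^-1. *)
Lemma deformed_ge_harm c : 0 < c ->
  (forall t, 0 < t -> (f t)^-1 <= 1 + c * (t^-1 - 1)) ->
  op_le (op_inv X) (\sum_j (w j)%:C *: op_inv (A j)).
Proof.
move=> c0 fc; apply: (op_le_affine_cancel c0); rewrite -wsum_affine.
have pY : posinv (\sum_j (w j)%:C *: op_inv (s X (A j))).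
  by apply: posinv_wsum => j; exact: posinv_inv.
have := (bnd sp).1; rewrite -XF /harm_mean => /(op_inv_le (posinv_inv pY)).
rewrite (op_invK pY) => /op_le_trans; apply; apply: wsum_le => j.
exact: (represented_inv_le fcont fhomo f_gt0 fs).
Qed.

End DeformedBounds.

Lemma sot_decr_add_scalar (R : realType) (E : hilbertType R) (A : bop E) :
  sot_decr (fun k => A + scalar_op E k.+1%:R^-1) A.
Proof.
split=> [k|x].
  rewrite /op_le opprD addrACA subrr add0r /scalar_op -scalerBl -rmorphB.
  apply: positive_scalar; rewrite subr_ge0 lef_pV2 ?posrE ?ltr0n // ler_nat //.
apply/cvg_nrP => e e0; exists (Num.truncn (nr x / e)) => k Nk.
rewrite bop_addE opprD addrA subrr sub0r nrN /scalar_op bop_scaleE nrZ.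
rewrite ger0_norm ?invr_ge0 ?ler0n // mulrC ler_pdivrMr ?ltr0n // -ler_pdivrMl //.
rewrite mulrC ltW // (lt_le_trans (truncnS_gt _)) // ler_nat ltnS //.
Qed.

(* If the representing function were constant, continuity from above would
   extend [A s B = A] from positive invertible to all positive operators. *)
Lemma representing_nonconstant (R : realType)
    (sigma : forall E : hilbertType R, bop E -> bop E -> bop E) (f : R -> R) :
  (forall E, kubo_ando (sigma E)) -> (forall E, represents f (sigma E)) ->
  ~ is_left_trivial sigma -> exists2 t, 0 < t & f t != 1.
Proof.
move=> KA fs nl; apply: contrapT => h; apply: nl => E A B A0 B0.
have f1 t : 0 < t -> f t = 1.
  by move=> t0; apply: contrapT => ft; apply: h; exists t => //; apply/eqP.
have pos (C : bop E) k : positive C -> posinv (C + scalar_op E k.+1%:R^-1).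
  move=> C0; apply: (@posinv_ge _ _ k.+1%:R^-1); first by rewrite invr_gt0.
  by rewrite /op_le addrK.
have trivial (C D : bop E) : posinv C -> posinv D -> sigma E C D = C.
  move=> pC pD; have [[sS sT SS ST TS] TT] := posinv_sqrt pC.
  rewrite (fs E) //; set S := op_pow C _ in sS SS ST TS *.
  set T := op_pow C _ in sT ST TS TT *.
  have [a [b [a0 ab Bab]]] := posinv_between (posinv_congr sT TS ST pD).1.
  have -> : fun_calc f (T * D * T) = 1.
    rewrite -[RHS](scale1r (1 : bop E)) -[RHS](@fun_calc_scalar _ _ _ _ _ Bab 1).
    apply: (fun_calc_ext ab Bab); last exact: cont_seg_cst.
    by move=> t /andP[at_ _]; rewrite f1 // (lt_le_trans a0).
  by rewrite mulr1.
have [_ _ _ scont _] := KA E.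
have [_ h1] := scont _ _ _ _ (fun k => (pos A k A0).1) (fun k => (pos B k B0).1) A0 B0
  (sot_decr_add_scalar A) (sot_decr_add_scalar B).
apply: sot_cvg_unique h1 _ => x; have := (sot_decr_add_scalar A).2 x.
by apply: cvg_trans; apply: near_eq_cvg; near=> k; rewrite trivial //; exact: pos.
Unshelve. all: by end_near. Qed.

Section PositiveMap.
Variables (R : realType) (H K : hilbertType R) (Phi : {linear bop H -> bop K}).
Hypotheses (Phi1 : Phi 1 = 1) (Phi_pos : forall X, positive X -> positive (Phi X)).

Lemma positive_map_le A B : op_le A B -> op_le (Phi A) (Phi B).
Proof. by move=> AB; have := Phi_pos AB; rewrite linearB. Qed.

Lemma positive_map_scalar c : Phi (scalar_op H c) = scalar_op K c.
Proof. by rewrite /scalar_op linearZ Phi1. Qed.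

Lemma positive_map_between a b A : op_between a b A -> op_between a b (Phi A).
Proof. by move=> [h k]; split; rewrite -positive_map_scalar; exact: positive_map_le. Qed.

End PositiveMap.

Section PowerBounds.
Variables (R : realType) (E : hilbertType R).
Implicit Types (A : bop E) (m M r : R).

Lemma op_pow_le_affine m M r A (g b : R) : 0 < m -> m <= M -> op_between m M A ->
  (forall t, m <= t <= M -> t `^ r <= g * t^-1 + b) ->
  op_le (op_pow A r) (g%:C *: op_inv A + scalar_op E b).
Proof.
move=> m0 mM Aab h; have [_ <-] := op_between_inv m0 mM Aab.
have ci := @cont_seg_inv R m M m0.
rewrite -(fun_calcZ mM Aab _ ci) -(@fun_calc_scalar _ _ _ _ _ Aab).
rewrite -(fun_calcD mM Aab (cont_segZ ci) (@cont_seg_cst _ _ _ b)).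
apply: (fun_calc_le mM Aab) => //; first exact: cont_seg_pow.
by move=> t tab; apply: cvgD; [exact: (cont_segZ ci)|exact: cvg_cst].
Qed.

Lemma op_pow_ge_affine m M r A (g b : R) : 0 < m -> m <= M -> op_between m M A ->
  (forall t, m <= t <= M -> g * t^-1 + b <= t `^ r) ->
  op_le (g%:C *: op_inv A + scalar_op E b) (op_pow A r).
Proof.
move=> m0 mM Aab h; have [_ <-] := op_between_inv m0 mM Aab.
have ci := @cont_seg_inv R m M m0.
rewrite -(fun_calcZ mM Aab _ ci) -(@fun_calc_scalar _ _ _ _ _ Aab).
rewrite -(fun_calcD mM Aab (cont_segZ ci) (@cont_seg_cst _ _ _ b)).
apply: (fun_calc_le mM Aab) => //; last exact: cont_seg_pow.
by move=> t tab; apply: cvgD; [exact: (cont_segZ ci)|exact: cvg_cst].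
Qed.

Lemma op_pow_between m M r A : 0 < m -> m <= M -> 0 <= r -> op_between m M A ->
  op_between (m `^ r) (M `^ r) (op_pow A r).
Proof.
move=> m0 mM r0 Aab; have M0 := lt_le_trans m0 mM.
split; rewrite -(@fun_calc_scalar _ _ _ _ _ Aab);
  apply: (fun_calc_le mM Aab); try exact: cont_seg_cst; try exact: cont_seg_pow.
- move=> t /andP[mt tM]; apply: ge0_ler_powR => //; rewrite nnegrE ltW //.
  exact: lt_le_trans mt.
- move=> t /andP[mt tM]; apply: ge0_ler_powR => //; rewrite nnegrE ltW //.
  exact: lt_le_trans mt.
Qed.

End PowerBounds.

Theorem theorem3p5 (R : realType) (H K : hilbertType R) (n : nat)
    (A : 'I_n -> bop H) (m M h : R)
    (m_gt0 : 0 < m) (ltmM : m < M) (hE : h = M / m)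
    (Apos : forall j, posinv (A j))
    (Abnd : forall j, op_le (scalar_op H m) (A j) /\ op_le (A j) (scalar_op H M))
    (Phi : {linear bop H -> bop K})
    (Phi1 : Phi 1 = 1)
    (Phi_pos : forall X, positive X -> positive (Phi X))
    (mean : forall E : hilbertType R, ('I_n -> bop E) -> bop E)
    (meanH : nvar_mean (mean H)) (meanK : nvar_mean (mean K))
    (w : 'I_n -> R) (w_ge0 : forall j, 0 <= w j) (w_sum : \sum_j w j = 1)
    (bndH : between_harm_arith w (mean H)) (bndK : between_harm_arith w (mean K))
    (sigma : forall E : hilbertType R, bop E -> bop E -> bop E)
    (sigma_mean : operator_mean sigma) (sigma_neq : ~ is_left_trivial sigma)
    (alpha : R) (alpha_gt0 : 0 < alpha) (r : R) (r_ge1 : 1 <= r) :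
  op_le (deformed (mean K) (sigma K) (fun j => Phi (op_pow (A j) r)))
    (alpha%:C *: Phi (op_pow (deformed (mean H) (sigma H) A) r)
     + scalar_op K (gamma (1 / M) (1 / m) (- r) (alpha * (kantorovich h r)^-1))).
Proof.
case: sigma_mean => KA [f [fmono f_ge0 f1 fs]].
have fcont : cont_pos f := proj1 fmono.
have fhomo := operator_monotone_homo fmono.
have f_gt0 := operator_monotone_gt0 fmono f_ge0 f1.
have [[s1 s10 s1P] [s2 s20 s2P]] := operator_monotone_tangents fmono f_ge0 f1
  (representing_nonconstant KA fs sigma_neq).
have M_gt0 : 0 < M := lt_trans m_gt0 ltmM.
have mM : m <= M := ltW ltmM.
have r0 : 0 <= r by lra.
set X := deformed (mean H) _ A.
have [pX XE] := deformedP meanH (KA H) (fs H) f1 m_gt0 mM Abnd.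
rewrite -/X in pX XE.
have X_ge := deformed_ge_harm (fs H) fcont fhomo f_gt0 w_ge0 w_sum bndH Apos pX XE s20 s2P.
have Bbnd j : op_between (m `^ r) (M `^ r) (Phi (op_pow (A j) r)).
  apply: positive_map_between => //; exact: op_pow_between.
have mr0 : 0 < m `^ r by exact: powR_gt0.
have mMr : m `^ r <= M `^ r by apply: ge0_ler_powR => //; rewrite nnegrE ltW.
set Z := deformed (mean K) _ _.
have [pZ ZE] := deformedP meanK (KA K) (fs K) f1 mr0 mMr Bbnd.
rewrite -/Z in pZ ZE.
have pB j : posinv (Phi (op_pow (A j) r)) := (op_between_inv mr0 mMr (Bbnd j)).1.
have Z_le := deformed_le_arith (fs K) fcont fhomo f_gt0 w_ge0 w_sum bndK pB pZ ZE s10 s1P.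
set D := \sum_j (w j)%:C *: op_inv (A j) in X_ge.
have Mm : 1 / M < 1 / m by rewrite !div1r ltf_pV2 ?posrE.
have iM0 : 0 < 1 / M by rewrite divr_gt0.
set a' := alpha * _; set gam := gamma _ _ _ _.
have h1 : 1 < h by rewrite hE ltr_pdivlMr // mul1r.
have K1 := kantorovich_ge1 h1 r_ge1.
have K0 : 0 < kantorovich h r := lt_le_trans ltr01 K1.
have a'0 : 0 < a' by rewrite mulr_gt0 ?invr_gt0.
have a'a : a' <= alpha by rewrite ger_pMr // invf_le1.
have Nr : - r < 0 by lra.
(* Slope and intercept of the chord of t^-r on [1/M, 1/m], used at the inverse of each A_j. *)
pose g := ((1 / m) `^ (- r) - (1 / M) `^ (- r)) / (1 / m - 1 / M).
pose b := (1 / m * (1 / M) `^ (- r) - 1 / M * (1 / m) `^ (- r)) / (1 / m - 1 / M).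
have powV t : 0 < t -> (t^-1) `^ (- r) = t `^ r.
  by move=> t0; rewrite -powR_inv1 ?(ltW t0) // -powRrM mulN1r opprK.
have powN t : 0 < t -> t^-1 `^ r = t `^ (- r).
  by move=> t0; rewrite -powV ?invr_gt0 // invrK.
have chord j : op_le (op_pow (A j) r) (g%:C *: op_inv (A j) + scalar_op H b).
  apply: (op_pow_le_affine m_gt0 mM (Abnd j)) => t /andP[mt tM].
  have t0 := lt_le_trans m_gt0 mt; rewrite -powV //.
  apply: powR_chord => //; last by left; exact: ltW.
  by rewrite !div1r !lef_pV2 ?posrE // tM mt.
have Dbnd : op_between (1 / M) (1 / m) D.
  rewrite !div1r /D; split; [rewrite -(wsum_const w_sum (scalar_op H M^-1))
    |rewrite -(wsum_const w_sum (scalar_op H m^-1))].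
    by apply: wsum_le => // j; case: (op_inv_between m_gt0 mM (Abnd j)).
  by apply: wsum_le => // j; case: (op_inv_between m_gt0 mM (Abnd j)).
have Z_le2 : op_le Z (Phi (g%:C *: D + scalar_op H b)).
  apply: op_le_trans Z_le _.
  have -> : g%:C *: D + scalar_op H b =
      \sum_j (w j)%:C *: (g%:C *: op_inv (A j) + scalar_op H b).
    under [RHS]eq_bigr do rewrite scalerDr scalerA mulrC -scalerA.
    by rewrite big_split /= -scaler_sumr (wsum_const w_sum).
  rewrite linear_sum /=.
  under [X in op_le _ X]eq_bigr do rewrite linearZ /=.
  by apply: wsum_le => // j; exact: positive_map_le.
have [a2 [b2 [a20 ab2 Xab]]] := posinv_between pX.
(* A self-adjoint operator lies between two scalars, and Phi preserves such bounds. *)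
have sPhi T : selfadj T -> selfadj (Phi T).
  move=> /op_bounds[c c0 [h1' h2']].
  exact: op_between_selfadj (positive_map_between Phi1 Phi_pos (conj h1' h2')).
have sXr : selfadj (op_pow X r).
  by apply: (fun_calc_selfadj ab2 Xab); exact: cont_seg_pow.
apply: qf_op_le => [||x].
- exact: posinv_selfadj.
- by apply: selfadjD; [apply/selfadjZ/sPhi|exact: selfadj_scalar].
have [->|x0] := eqVneq x 0.
  by rewrite /qf !bop_fun0 !rip0l.
set N := nr x ^+ 2.
have N0 : 0 < N.
  rewrite exprn_gt0 // lt_def nr_ge0 andbT.
  by apply: contra x0 => /eqP/nr_eq0 ->.
rewrite qfD qfZ qf_scalar -/N.
pose y := qf (Phi D) x / N.
have yE : qf (Phi D) x = y * N by rewrite /y divfK // gt_eqF.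
have ybnd : 1 / M <= y <= 1 / m.
  by rewrite /y ler_pdivlMr // ler_pdivrMr // op_between_qf //; exact: positive_map_between.
have y0 : 0 < y by case/andP: ybnd => /(lt_le_trans iM0).
have := op_le_qf Z_le2 x.
rewrite linearD linearZ /= (positive_map_scalar Phi1) qfD qfZ qf_scalar -/N yE => ZN.
have gb := gamma_bound iM0 Mm Nr a'0 ybnd; rewrite -/g -/b -/gam in gb.
(* The tangent slope [c] at [y] is nonpositive, so the upper bound [D] for X^-1 yields a lower
   bound, which at this [y] collapses to y^-r. *)
have jensen : y `^ (- r) * N <= qf (Phi (op_pow X r)) x.
  pose c := - r * y `^ (- r - 1).
  have c0 : c <= 0 by rewrite /c nmulr_rle0 ?powR_ge0.
  have Xr : op_le (c%:C *: op_inv X + scalar_op H (y `^ (- r) - c * y)) (op_pow X r).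
    apply: (op_pow_ge_affine a20 ab2 Xab) => t /andP[at_ _].
    have t0 := lt_le_trans a20 at_; have ti0 : 0 < t^-1 by rewrite invr_gt0.
    have := powR_tangent y0 ti0 (or_introl (ltW Nr)); rewrite powV // -/c; lra.
  have := op_le_qf (positive_map_le Phi_pos Xr) x.
  rewrite linearD linearZ /= (positive_map_scalar Phi1) qfD qfZ qf_scalar -/N.
  have := op_le_qf (positive_map_le Phi_pos X_ge) x; rewrite yE; nra.
have yr0 : 0 <= y `^ (- r) by exact: powR_ge0.
have k1 : (g * y + b) * N <= (a' * y `^ (- r) + gam) * N by rewrite ler_pM2r.
have q0 : 0 <= qf (Phi (op_pow X r)) x.
  by apply: le_trans jensen; rewrite mulr_ge0 // ltW.
have k2 := ler_wpM2l (ltW a'0) jensen.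
have k3 := ler_wpM2r q0 a'a.
by move: ZN k1 k2 k3; lra.
Qed.
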